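(* Let $a,b,c$ be real numbers with $a\ge c>0$ and $b\ge c>0$, and let $\gamma>0$. If $f\in\mathcal{A}$ satisfies $$\Re\left\{\frac{\mathcal{I}_{a+1,b}^{c}f(z)}{\mathcal{I}_{a,b}^{c}f(z)}\right\}<1+\frac{1}{2a\gamma}\qquad(z\in\mathcal{U}),$$ then $$\frac{\mathcal{I}_{a,b}^{c}f(z)}{z}\prec(1+z)^{1/\gamma}\qquad(z\in\mathcal{U}),$$ and the result is the best possible.
   Context: $\mathcal{U}=\{z\in\mathbb{C}:|z|<1\}$. $\mathcal{A}$ is the class of functions analytic in $\mathcal{U}$ of the form $f(z)=z+\sum_{k\ge2}a_kz^k$. $(\alpha)_0=1$ and $(\alpha)_n=\alpha(\alpha+1)\cdots(\alpha+n-1)$ for $n\ge1$. The Hohlov operator $\mathcal{I}_{a,b}^{c}:\mathcal{A}\to\mathcal{A}$ is the Hadamard product (coefficientwise product of power series) of $f$ with $z\,{}_2F_1(a,b;c;z)$, i.e. $\mathcal{I}_{a,b}^{c}f(z)=z+\sum_{n\ge1}\frac{(a)_n(b)_n}{(c)_n\,n!}a_{n+1}z^{n+1}$. For $g,h$ analytic in $\mathcal{U}$, $g\prec h$ means $g(z)=h(\omega(z))$ for some analytic $\omega$ on $\mathcal{U}$ with $\omega(0)=0$, $|\omega(z)|<1$. Powers are principal branches; the quotient $\mathcal{I}_{a+1,b}^{c}f(z)/\mathcal{I}_{a,b}^{c}f(z)$ is assigned its limit value $1$ at $z=0$. ''Best possible'' means that the constant $1+\frac{1}{2a\gamma}$ in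 the hypothesis cannot be replaced by any larger number. *)

(* Defs.v *)
From Stdlib Require Import Reals Lra Arith Factorial.
From Coquelicot Require Import Coquelicot.
Open Scope R_scope.

Definition in_disk (z : C) : Prop := Cmod z < 1.

(* [ex_derive] is taken over the field [C], i.e. complex differentiability. *)
Definition analytic_in_disk (g : C -> C) : Prop :=
  forall z : C, in_disk z -> ex_derive (K := C_AbsRing) (V := C_NormedModule) g z.

(* The class A; the coefficient sequence is determined by the restriction of
   the function to the disk. *)
Record classA : Type := MkClassA {
  Afun :> C -> C;
  Acoef : nat -> C;
  Afun_analytic : analytic_in_disk Afun;
  Acoef_0 : Acoef 0%nat = RtoC 0;
  Acoef_1 : Acoef 1%nat = RtoC 1;
  Afun_series : forall z : C, in_disk z ->
    is_pseries (K := C_AbsRing) (V := C_NormedModule) Acoef z (Afun z)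
}.

(* Sum of a complex power series (Coquelicot's [PSeries] is real); see
   [CPSeries_unique]. *)
Definition CPSeries (u : nat -> C) (z : C) : C :=
  (Series (fun n => Re (u n * z ^ n)%C), Series (fun n => Im (u n * z ^ n)%C)).

Lemma CPSeries_unique (u : nat -> C) (z l : C) :
  is_pseries (K := C_AbsRing) (V := C_NormedModule) u z l -> CPSeries u z = l.
Proof.
intros H.
assert (Hpow : forall n, pow_n (K := C_AbsRing) z n = (z ^ n)%C).
{ induction n as [|n IH]; [reflexivity|].
  simpl; rewrite IH; reflexivity. }
assert (H' : is_series (K := C_AbsRing) (V := C_NormedModule)
               (fun n => (u n * z ^ n)%C) l).
{ apply (is_series_ext (fun n => scal (pow_n (K := C_AbsRing) z n) (u n)));
    [|exact H].
  intros n; rewrite Hpow; apply Cmult_comm. }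
clear H Hpow.
assert (Hre : forall n, Re (sum_n (fun n => (u n * z ^ n)%C) n)
              = sum_n (fun n => Re (u n * z ^ n)%C) n).
{ induction n as [|n IH]; [now rewrite !sum_O|].
  rewrite !sum_Sn, <- IH; reflexivity. }
assert (Him : forall n, Im (sum_n (fun n => (u n * z ^ n)%C) n)
              = sum_n (fun n => Im (u n * z ^ n)%C) n).
{ induction n as [|n IH]; [now rewrite !sum_O|].
  rewrite !sum_Sn, <- IH; reflexivity. }
assert (Hball : forall eps : posreal, eventually (fun n =>
   Cmod (sum_n (fun n => (u n * z ^ n)%C) n - l) < eps)).
{ intros eps.
  exact (proj1 (filterlim_locally_ball_norm (K := C_AbsRing)
           (U := C_NormedModule) _ l) H' eps). }
unfold CPSeries; rewrite (surjective_pairing l); f_equal;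
  apply is_series_unique; apply (proj2 (filterlim_locally _ _)); intros eps;
  destruct (Hball eps) as [N HN]; exists N; intros n Hn; specialize (HN n Hn);
  refine (Rle_lt_trans _ _ _ _ HN).
- rewrite <- Hre.
  refine (Rle_trans _ _ _ _ (Rmax_Cmod _)); apply Rmax_l.
- rewrite <- Him.
  refine (Rle_trans _ _ _ _ (Rmax_Cmod _)); apply Rmax_r.
Qed.

(* Rising factorial (x)_n. *)
Fixpoint poch (x : R) (n : nat) : R :=
  match n with
  | O => 1
  | S k => poch x k * (x + INR k)
  end.

(* Taylor coefficients of 2F1(a,b;c;z). *)
Definition hyp2F1_coef (a b c : R) (n : nat) : C :=
  RtoC (poch a n * poch b n / (poch c n * INR (fact n))).

Definition hadamard (u v : nat -> C) (n : nat) : C := (u n * v n)%C.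

(* [PS_incr_1] multiplies the series by z. *)
Definition hohlov (a b c : R) (f : classA) (z : C) : C :=
  CPSeries (hadamard (PS_incr_1 (K := C_AbsRing) (V := C_NormedModule) (hyp2F1_coef a b c)) (Acoef f)) z.

(* The quotient g/h with the value 1 at the origin, for g and h having the
   same leading term there.  Away from the origin, division by 0 gives 0. *)
Definition quotient1 (g h : C -> C) (z : C) : C :=
  if Ceq_dec z (RtoC 0) then RtoC 1 else (g z / h z)%C.

(* Principal argument, in (-PI, PI]. *)
Definition Carg (w : C) : R :=
  if Rle_dec 0 (Im w) then acos (Re w / Cmod w) else - acos (Re w / Cmod w).

Definition Cexp (w : C) : C := (exp (Re w) * cos (Im w), exp (Re w) * sin (Im w)).

Definition Clog (w : C) : C := (ln (Cmod w), Carg w).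

(* Principal branch of w^s, meaningful for w <> 0. *)
Definition Cpower (w s : C) : C := Cexp (s * Clog w)%C.

Definition subordinate (g h : C -> C) : Prop :=
  exists omega : C -> C,
    analytic_in_disk omega /\
    omega (RtoC 0) = RtoC 0 /\
    (forall z : C, in_disk z -> Cmod (omega z) < 1) /\
    (forall z : C, in_disk z -> g z = h (omega z)).

(* Main.v *)
(* Write I_{a,b}^c f = z P with P a power series and P(0) = 1.  On coefficients
   I_{a+1,b}^c f = z (P + z P' / a), so the hypothesis says
   Re (z P' / P) < 1 / (2 gamma) wherever P does not vanish.

   On a disk |z| < R where P has no zero it has an analytic logarithm L with
   L(0) = 0; let w = exp (gamma L) - 1, so that
   z w' / (1 + w) = gamma z P' / P.  At a point z0 of |z| = r where |w| is
   largest, Schwarz's lemma and Jack's argument give z0 w'(z0) = k w(z0) with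
   k >= 1, and |w(z0)| >= 1 would make Re (z0 w' / (1 + w)) at least 1/2.  Hence
   |w(z)| <= |z| / R, which is the subordination once R = 1.

   P has no zero at all: the hypothesis bounds the radial growth rate of log |P|
   from above, so a zero z0 would force P = 0 on the rest of the ray through z0,
   hence P would be flat at z0 along the ray; but if |z0| = R is minimal, the
   above gives |P(t z0)| >= (1 - t)^(1/gamma) for t < 1.

   The constant is sharp because of P = (1 + z)^s with s = 2 a (K - 1). *)
Require Import Defs.
From Stdlib Require Import Reals Lra Lia Factorial List Classical ClassicalEpsilon.
From Coquelicot Require Import Coquelicot.
Open Scope R_scope.

(** * Complex derivatives and compactness *)


(** At a zero of [P] the quotient takes a default value and the hypothesis is silent, so zeros must
    be excluded by what happens around them. The classical way, through the pole of P'/P, rests on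
    the identity theorem and a local factorisation. The ray argument replaces both: by the
    differential inequality d|P|^2/ds <= 2 M |P|^2 along the points s z0 with s >= 1 and M = 1 / (2
    gamma), which also holds where [P] vanishes, and by flatness of one finite order exceeding 1 /
    gamma. The logarithm is then needed only up to the nearest zero, which is why the Schwarz-type
    bound is proved for a disk of arbitrary radius.

    No contour integral occurs. Power series are differentiated by an explicit remainder estimate,
    the logarithm is continued along the dilations P(t z), and the maximum principle comes from
    second derivatives at a maximum. *)

Definition cder (f : C -> C) (z l : C) : Prop :=
  forall eps, 0 < eps -> exists d, 0 < d /\ forall y, Cmod (y - z) < d ->
    Cmod (f y - f z - l * (y - z)) <= eps * Cmod (y - z).

Lemma cder_is_derive (f : C -> C) (z l : C) :
  cder f z l <-> @is_derive C_AbsRing (AbsRing_NormedModule C_AbsRing) f z l.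
Proof.
split.
- intros H; split; [apply is_linear_scal_l|].
  intros x Hx; rewrite <- (@is_filter_lim_locally_unique C_AbsRing (AbsRing_NormedModule C_AbsRing) z x Hx); intros eps.
  destruct (H eps (cond_pos eps)) as [d [Hd H']].
  exists (mkposreal d Hd); intros y Hy; specialize (H' y Hy).
  change (Cmod (f y - f z - (y - z) * l)%C <= eps * Cmod (y - z)%C).
  now rewrite (Cmult_comm (y - z) l).
- intros [_ H] eps Heps.
  destruct (H z (fun P HP => HP) (mkposreal eps Heps)) as [d Hd].
  exists d; split; [apply cond_pos|]; intros y Hy; specialize (Hd y Hy).
  now rewrite (Cmult_comm l (y - z)).
Qed.

(** The conclusion lives in [C_NormedModule], the structure that [analytic_in_disk] refers to,
    whereas the calculus rules are taken from [AbsRing_NormedModule C_AbsRing]. Both have the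
    modulus as norm, so the same argument serves twice. *)
Lemma cder_ex_derive (f : C -> C) (z l : C) :
  cder f z l -> ex_derive (K := C_AbsRing) (V := C_NormedModule) f z.
Proof.
intros H; exists l; split; [apply is_linear_scal_l|].
intros x Hx; rewrite <- (@is_filter_lim_locally_unique C_AbsRing (AbsRing_NormedModule C_AbsRing) z x Hx); intros eps.
destruct (H eps (cond_pos eps)) as [d [Hd H']].
exists (mkposreal d Hd); intros y Hy; specialize (H' y Hy).
change (Cmod (f y - f z - (y - z) * l)%C <= eps * Cmod (y - z)%C).
now rewrite (Cmult_comm (y - z) l).
Qed.

Lemma cder_const (c z : C) : cder (fun _ => c) z 0.
Proof. apply cder_is_derive, @is_derive_const. Qed.

Lemma cder_id (z : C) : cder (fun y => y) z 1.
Proof. apply cder_is_derive, @is_derive_id. Qed.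

Lemma cder_plus (f g : C -> C) (z l m : C) :
  cder f z l -> cder g z m -> cder (fun y => f y + g y)%C z (l + m).
Proof.
rewrite !cder_is_derive; intros H1 H2.
exact (is_derive_plus (V := AbsRing_NormedModule C_AbsRing) f g z l m H1 H2).
Qed.

Lemma cder_mult (f g : C -> C) (z l m : C) :
  cder f z l -> cder g z m -> cder (fun y => f y * g y)%C z (l * g z + f z * m).
Proof.
rewrite !cder_is_derive; intros H1 H2.
exact (is_derive_mult (K := C_AbsRing) f g z l m H1 H2 Cmult_comm).
Qed.

Lemma cder_comp (f g : C -> C) (z l m : C) :
  cder f (g z) l -> cder g z m -> cder (fun y => f (g y)) z (m * l).
Proof.
rewrite !cder_is_derive; intros H1 H2.
exact (is_derive_comp (V := AbsRing_NormedModule C_AbsRing) f g z l m H1 H2).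
Qed.

Lemma cder_eq (f : C -> C) (z l m : C) : cder f z l -> l = m -> cder f z m.
Proof. now intros H <-. Qed.

Lemma cder_ext (f g : C -> C) (z l : C) (d : R) : 0 < d ->
  (forall y, Cmod (y - z) < d -> f y = g y) -> cder f z l -> cder g z l.
Proof.
intros Hd Hfg H eps Heps.
destruct (H eps Heps) as [d' [Hd' H']].
exists (Rmin d d'); split; [now apply Rmin_pos|]; intros y Hy.
rewrite <- !Hfg; [apply H' | |]; try (eapply Rlt_le_trans; [exact Hy|]).
- apply Rmin_r.
- replace (z - z)%C with (RtoC 0) by ring; now rewrite Cmod_0.
- apply Rmin_l.
Qed.

Lemma Cmod_minus_sym (y z : C) : Cmod (y - z) = Cmod (z - y).
Proof. rewrite <- Cmod_opp; f_equal; ring. Qed.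

Lemma Cmod_triangle_rev (y z : C) : Cmod y - Cmod z <= Cmod (y - z).
Proof.
generalize (Cmod_triangle (y - z) z); replace (y - z + z)%C with y by ring; lra.
Qed.

Lemma cder_cont (f : C -> C) (z l : C) (eps : R) : cder f z l -> 0 < eps ->
  exists d, 0 < d /\ forall y, Cmod (y - z) < d -> Cmod (f y - f z) < eps.
Proof.
intros H Heps; destruct (H 1 Rlt_0_1) as [d [Hd H']].
pose proof (Cmod_ge_0 l) as Hl.
exists (Rmin d (eps / (Cmod l + 2))); split.
{ apply Rmin_pos; [assumption|]; apply Rdiv_lt_0_compat; lra. }
intros y Hy.
assert (H1 : Cmod (y - z) < d) by (eapply Rlt_le_trans; [exact Hy|apply Rmin_l]).
assert (H2 : Cmod (y - z) < eps / (Cmod l + 2))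
  by (eapply Rlt_le_trans; [exact Hy|apply Rmin_r]).
specialize (H' y H1).
replace (f y - f z)%C with ((f y - f z - l * (y - z)) + l * (y - z))%C by ring.
eapply Rle_lt_trans; [apply Cmod_triangle|]; rewrite Cmod_mult.
apply (Rmult_lt_compat_r (Cmod l + 2)) in H2; [|lra].
unfold Rdiv in H2; rewrite Rmult_assoc, Rinv_l in H2 by lra.
generalize (Cmod_ge_0 (y - z)); nra.
Qed.

Lemma cder_inv_id (z : C) : z <> 0%C -> cder (fun y => / y)%C z (- / (z * z)).
Proof.
intros Hz eps Heps.
assert (Hm : 0 < Cmod z) by (now apply Cmod_gt_0).
exists (Rmin (Cmod z / 2) (eps * (Cmod z * Cmod z * Cmod z) / 2)); split.
{ apply Rmin_pos; [lra|]; assert (0 < Cmod z * Cmod z * Cmod z) by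
   (repeat apply Rmult_lt_0_compat; assumption); nra. }
intros y Hy.
assert (H1 : Cmod (y - z) < Cmod z / 2)
  by (eapply Rlt_le_trans; [exact Hy|apply Rmin_l]).
assert (H2 : Cmod (y - z) < eps * (Cmod z * Cmod z * Cmod z) / 2)
  by (eapply Rlt_le_trans; [exact Hy|apply Rmin_r]).
assert (Hy2 : Cmod z / 2 < Cmod y).
{ generalize (Cmod_triangle_rev z y); rewrite (Cmod_minus_sym z y); lra. }
assert (Hy0 : y <> 0%C) by (apply Cmod_gt_0; lra).
replace (/ y - / z - - / (z * z) * (y - z))%C
  with ((y - z) * (y - z) / (y * (z * z)))%C by (field; now split).
assert (Hyz : (y * (z * z))%C <> 0%C) by (repeat apply Cmult_neq_0; assumption).
rewrite Cmod_div, !Cmod_mult by assumption.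
assert (HA : 0 < Cmod y * (Cmod z * Cmod z)) by
   (repeat apply Rmult_lt_0_compat; lra).
apply (Rmult_le_reg_r _ _ _ HA).
unfold Rdiv; rewrite Rmult_assoc, Rinv_l by lra.
assert (HB : Cmod z * Cmod z * Cmod z / 2 <= Cmod y * (Cmod z * Cmod z)).
{ assert (0 < Cmod z * Cmod z) by nra; nra. }
generalize (Cmod_ge_0 (y - z)); intros H0.
assert (Cmod (y - z) <= eps * (Cmod y * (Cmod z * Cmod z))) by nra.
nra.
Qed.

Lemma cder_inv (f : C -> C) (z l : C) : f z <> 0%C -> cder f z l ->
  cder (fun y => / f y)%C z (- l / (f z * f z)).
Proof.
intros Hz H.
apply (cder_eq _ _ _ _ (cder_comp (fun y => / y)%C f z _ _ (cder_inv_id _ Hz) H)).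
field; assumption.
Qed.

Lemma cder_opp (f : C -> C) (z l : C) : cder f z l -> cder (fun y => - f y)%C z (- l).
Proof.
intros H.
apply (cder_ext (fun y => (RtoC (-1)) * f y)%C _ _ _ 1 Rlt_0_1).
{ intros y _; apply injective_projections; simpl; ring. }
apply (cder_eq _ _ _ _ (cder_mult _ _ _ _ _ (cder_const _ _) H)).
apply injective_projections; simpl; ring.
Qed.

Lemma cder_scal (c : C) (f : C -> C) (z l : C) :
  cder f z l -> cder (fun y => c * f y)%C z (c * l).
Proof.
intros H; apply (cder_eq _ _ _ _ (cder_mult _ _ _ _ _ (cder_const c _) H)); ring.
Qed.

Lemma cder_minus (f g : C -> C) (z l m : C) :
  cder f z l -> cder g z m -> cder (fun y => f y - g y)%C z (l - m).
Proof. intros H1 H2; exact (cder_plus _ _ _ _ _ H1 (cder_opp _ _ _ H2)). Qed.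

Lemma im_le_Cmod (z : C) : Rabs (Im z) <= Cmod z.
Proof. eapply Rle_trans; [apply Rmax_r|apply Rmax_Cmod]. Qed.

Lemma Cmod_le_re_im (z : C) : Cmod z <= Rabs (Re z) + Rabs (Im z).
Proof.
unfold Cmod, Re, Im; rewrite <- (sqrt_Rsqr (Rabs (fst z) + Rabs (snd z))).
- apply sqrt_le_1_alt; rewrite <- (pow2_abs (fst z)), <- (pow2_abs (snd z)).
  unfold Rsqr; generalize (Rabs_pos (fst z)) (Rabs_pos (snd z)); nra.
- generalize (Rabs_pos (fst z)) (Rabs_pos (snd z)); lra.
Qed.

Lemma is_derive_of_bound (f : R -> R) (t l : R) :
  (forall eps, 0 < eps -> exists d, 0 < d /\ forall h, Rabs h < d ->
     Rabs (f (t + h) - f t - l * h) <= eps * Rabs h) ->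
  is_derive f t l.
Proof.
intros H; apply is_derive_Reals; intros eps Heps.
destruct (H (eps / 2)) as [d [Hd Hb]]; [lra|].
exists (mkposreal d Hd); intros h Hh0 Hh; specialize (Hb h Hh).
replace ((f (t + h) - f t) / h - l) with ((f (t + h) - f t - l * h) / h)
  by (field; assumption).
unfold Rdiv; rewrite Rabs_mult, Rabs_inv.
assert (0 < Rabs h) by (now apply Rabs_pos_lt).
apply (Rmult_lt_reg_r (Rabs h)); [assumption|].
rewrite Rmult_assoc, Rinv_l by lra; nra.
Qed.

Lemma cder_line_bound (f : C -> C) (w e : C) (t : R) (l : C) :
  cder f (w + t * e)%C l ->
  forall eps, 0 < eps -> exists d, 0 < d /\ forall h, Rabs h < d ->
   Cmod (f (w + RtoC (t + h) * e)%C - f (w + t * e)%C - l * e * h) <= eps * Rabs h.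
Proof.
intros H eps Heps; pose proof (Cmod_ge_0 e) as He.
destruct (H (eps / (Cmod e + 1))) as [d [Hd Hb]]; [apply Rdiv_lt_0_compat; lra|].
exists (d / (Cmod e + 1)); split; [apply Rdiv_lt_0_compat; lra|]; intros h Hh.
assert (E : ((w + RtoC (t + h) * e) - (w + t * e) = h * e)%C)
  by (rewrite RtoC_plus; ring).
specialize (Hb (w + RtoC (t + h) * e)%C); rewrite E in Hb.
rewrite Cmod_mult, Cmod_R in Hb.
apply (Rmult_lt_compat_r (Cmod e + 1)) in Hh; [|lra].
unfold Rdiv in Hh; rewrite Rmult_assoc, Rinv_l in Hh by lra.
pose proof (Rabs_pos h) as Hh0.
replace (l * e * h)%C with (l * (h * e))%C by ring.
eapply Rle_trans; [apply Hb; nra|].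
unfold Rdiv; rewrite Rmult_assoc.
apply Rmult_le_compat_l; [lra|].
apply (Rmult_le_reg_l (Cmod e + 1)); [lra|].
rewrite <- Rmult_assoc, Rinv_r by lra; nra.
Qed.

Lemma cder_line_re (f : C -> C) (w e : C) (t : R) (l : C) :
  cder f (w + t * e)%C l ->
  is_derive (fun t : R => Re (f (w + t * e)%C)) t (Re (l * e)%C).
Proof.
intros H; apply is_derive_of_bound; intros eps Heps.
destruct (cder_line_bound _ _ _ _ _ H eps Heps) as [d [Hd Hb]].
exists d; split; [assumption|]; intros h Hh; eapply Rle_trans; [|apply (Hb h Hh)].
eapply Rle_trans; [|apply re_le_Cmod]; right; f_equal; unfold Re, Im; simpl; ring.
Qed.

Lemma cder_line_im (f : C -> C) (w e : C) (t : R) (l : C) :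
  cder f (w + t * e)%C l ->
  is_derive (fun t : R => Im (f (w + t * e)%C)) t (Im (l * e)%C).
Proof.
intros H; apply is_derive_of_bound; intros eps Heps.
destruct (cder_line_bound _ _ _ _ _ H eps Heps) as [d [Hd Hb]].
exists d; split; [assumption|]; intros h Hh; eapply Rle_trans; [|apply (Hb h Hh)].
eapply Rle_trans; [|apply im_le_Cmod]; right; f_equal; unfold Re, Im; simpl; ring.
Qed.

Lemma MVT_derive (f df : R -> R) (a b : R) : a < b ->
  (forall x, a <= x <= b -> is_derive f x (df x)) ->
  exists c, a < c < b /\ f b - f a = df c * (b - a).
Proof.
intros Hab H; destruct (MVT_cor2 f df a b Hab) as [c [E Hc]].
- intros x Hx; apply is_derive_Reals, H, Hx.
- now exists c.
Qed.

(** The real mean value theorem is applied to the real and the imaginary part separately; their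
    intermediate points differ, hence the factor 2. *)
Lemma cder_mean_value (f df : C -> C) (y z : C) (B : R) :
  (forall t, 0 <= t <= 1 -> cder f (z + t * (y - z))%C (df (z + t * (y - z))%C)) ->
  (forall t, 0 <= t <= 1 -> Cmod (df (z + t * (y - z))%C) <= B) ->
  Cmod (f y - f z) <= 2 * B * Cmod (y - z).
Proof.
intros Hd HB.
assert (E0 : (z + 0 * (y - z) = z)%C) by ring.
assert (E1 : (z + 1 * (y - z) = y)%C) by ring.
destruct (MVT_derive (fun t : R => Re (f (z + t * (y - z))%C))
  (fun t : R => Re (df (z + t * (y - z)) * (y - z))%C) 0 1) as [c1 [Hc1 E]];
  [lra|intros x Hx; apply cder_line_re, Hd, Hx|].
destruct (MVT_derive (fun t : R => Im (f (z + t * (y - z))%C))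
  (fun t : R => Im (df (z + t * (y - z)) * (y - z))%C) 0 1) as [c2 [Hc2 E']];
  [lra|intros x Hx; apply cder_line_im, Hd, Hx|].
rewrite E0, E1 in E, E'.
eapply Rle_trans; [apply Cmod_le_re_im|].
replace (Re (f y - f z)%C) with (Re (f y) - Re (f z)) by reflexivity.
replace (Im (f y - f z)%C) with (Im (f y) - Im (f z)) by reflexivity.
rewrite E, E'.
replace (1 - 0) with 1 by ring; rewrite !Rmult_1_r.
assert (H : forall t, 0 <= t <= 1 ->
  Cmod (df (z + t * (y - z)) * (y - z))%C <= B * Cmod (y - z)).
{ intros t Ht; rewrite Cmod_mult; apply Rmult_le_compat_r, HB, Ht; apply Cmod_ge_0. }
generalize (H c1 ltac:(lra)) (H c2 ltac:(lra)) (re_le_Cmod (df (z + c1 * (y - z)) * (y - z))%C)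
  (im_le_Cmod (df (z + c2 * (y - z)) * (y - z))%C); lra.
Qed.

Lemma segment_in_disk (z : C) (r t : R) : Cmod z < r -> 0 <= t <= 1 ->
  Cmod (0 + t * (z - 0))%C < r.
Proof.
intros Hz Ht; replace (0 + t * (z - 0))%C with (t * z)%C by ring.
rewrite Cmod_mult, Cmod_R, Rabs_pos_eq by lra.
generalize (Cmod_ge_0 z); nra.
Qed.

Lemma cder_zero_const (f : C -> C) (r : R) :
  (forall z, Cmod z < r -> cder f z 0) -> forall z, Cmod z < r -> f z = f 0%C.
Proof.
intros H z Hz.
assert (E : Cmod (f z - f 0%C) <= 2 * 0 * Cmod (z - 0)).
{ apply (cder_mean_value f (fun _ => 0%C)).
  - intros t Ht; apply H, segment_in_disk; assumption.
  - intros t Ht; rewrite Cmod_0; lra. }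
assert (E' : Cmod (f z - f 0%C) = 0) by (generalize (Cmod_ge_0 (f z - f 0%C)); lra).
apply Cmod_eq_0 in E'.
replace (f z) with (f z - f 0%C + f 0%C)%C by ring; rewrite E'; ring.
Qed.

(* Every point of the plane has a neighbourhood on which [f] is, within [K],
    below some value attained on [K]; the largest of finitely many of these
    values would have to be below itself. *)
Lemma usc_attains_max (K : C -> Prop) (f : C -> R) (M : R) (z0 : C) :
  K z0 -> (forall z, K z -> Cmod z <= M) ->
  (forall z, ~ K z -> exists d, 0 < d /\ forall y, Cmod (y - z) < d -> ~ K y) ->
  (forall z eps, K z -> 0 < eps -> exists d, 0 < d /\
     forall y, K y -> Cmod (y - z) < d -> f y < f z + eps) ->
  exists z, K z /\ forall y, K y -> f y <= f z.
Proof.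
intros Hz0 HM Hcl Husc; apply NNPP; intros Hno.
assert (Hloc : forall z : C, exists p : posreal * C, K (snd p) /\
  forall y, K y -> Cmod (y - z) < fst p -> f y < f (snd p)).
{ intros z; destruct (classic (K z)) as [Hz|Hz].
  - destruct (classic (exists w, K w /\ f z < f w)) as [[w [Hw Hfw]]|Hnw].
    + destruct (Husc z (f w - f z) Hz) as [d [Hd H]]; [lra|].
      exists (mkposreal d Hd, w); split; [exact Hw|]; intros y Hy Hyz.
      specialize (H y Hy Hyz); simpl; lra.
    + exfalso; apply Hno; exists z; split; [exact Hz|]; intros y Hy.
      apply Rnot_lt_le; intros Hlt; apply Hnw; now exists y.
  - destruct (Hcl z Hz) as [d [Hd H]].
    exists (mkposreal d Hd, z0); split; [exact Hz0|]; intros y Hy Hyz.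
    now destruct (H y Hyz). }
set (P := fun z => proj1_sig (constructive_indefinite_description _ (Hloc z))).
assert (HP : forall z, K (snd (P z)) /\
  forall y, K y -> Cmod (y - z) < fst (P z) -> f y < f (snd (P z))).
{ intros z; exact (proj2_sig (constructive_indefinite_description _ (Hloc z))). }
clearbody P.
set (pt := fun x : Compactness.Tn 2 R => (fst x, fst (snd x)) : C).
(* The cover controls each coordinate separately, and the modulus is at most the sum of both
   deviations; hence half the radius. *)
assert (Hdpos : forall x : Compactness.Tn 2 R, 0 < fst (P (pt x)) / 2).
{ intros x; generalize (cond_pos (fst (P (pt x)))); lra. }
apply (compactness_list 2 (- M, (- M, tt)) (M, (M, tt))
  (fun x => mkposreal _ (Hdpos x))); intros [l Hl].
assert (Hcov : forall y, K y -> exists t, In t l /\ f y < f (snd (P (pt t)))).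
{ intros y Hy; destruct (Hl (fst y, (snd y, tt))) as [t [Ht [_ Hc]]].
  - specialize (HM y Hy).
    generalize (re_le_Cmod y) (im_le_Cmod y); unfold Re, Im; intros H1 H2.
    apply Rle_trans with (2 := HM), Rabs_le_between in H1.
    apply Rle_trans with (2 := HM), Rabs_le_between in H2.
    simpl; tauto.
  - exists t; split; [exact Ht|]; apply (proj2 (HP (pt t))); [exact Hy|].
    destruct t as [t1 [t2 []]]; destruct Hc as [Hc1 [Hc2 _]]; simpl in Hc1, Hc2.
    eapply Rle_lt_trans; [apply Cmod_le_re_im|]; simpl in *.
    unfold pt in *; simpl in *; unfold Rminus in *; lra. }
assert (Hmax : forall l' : list (Compactness.Tn 2 R), l' <> nil ->
  exists t, In t l' /\ forall t', In t' l' -> f (snd (P (pt t'))) <= f (snd (P (pt t)))).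
{ induction l' as [|x l' IH]; [congruence|]; intros _.
  destruct (classic (l' = nil)) as [->|Hne].
  - exists x; split; [now left|]; intros t' [<-|[]]; lra.
  - destruct (IH Hne) as [t [Ht H]].
    destruct (Rle_dec (f (snd (P (pt t)))) (f (snd (P (pt x))))) as [Hc|Hc].
    + exists x; split; [now left|]; intros t' [<-|Ht']; [lra|].
      specialize (H _ Ht'); lra.
    + exists t; split; [now right|]; intros t' [<-|Ht']; [lra|auto]. }
destruct (Hcov z0 Hz0) as [t0 [Ht0 _]].
destruct (Hmax l) as [t [Ht H]]; [intros ->; destruct Ht0|].
destruct (Hcov _ (proj1 (HP (pt t)))) as [t' [Ht' Hlt]].
specialize (H _ Ht'); lra.
Qed.

(** * Complex power series *)


(** Radius of convergence at least 1, in a form stable under shifts, termwise products and termwise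
    differentiation. *)
Definition subexp (u : nat -> C) : Prop :=
  forall q, 1 < q -> exists M, forall n, Cmod (u n) <= M * q ^ n.

(** Convergence by components, to match the definition of [CPSeries]. *)
Definition is_Cseries (t : nat -> C) (l : C) : Prop :=
  is_series (fun n => Re (t n)) (Re l) /\ is_series (fun n => Im (t n)) (Im l).

Lemma CPSeries_is_Cseries (u : nat -> C) (z l : C) :
  is_Cseries (fun n => u n * z ^ n)%C l -> CPSeries u z = l.
Proof.
intros [H1 H2]; unfold CPSeries.
rewrite (is_series_unique _ _ H1), (is_series_unique _ _ H2).
now destruct l.
Qed.

Lemma is_Cseries_ext (s t : nat -> C) (l : C) :
  (forall n, s n = t n) -> is_Cseries s l -> is_Cseries t l.
Proof.
intros E [H1 H2]; split.
- apply (is_series_ext (fun n => Re (s n))); [intros n; now rewrite E|exact H1].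
- apply (is_series_ext (fun n => Im (s n))); [intros n; now rewrite E|exact H2].
Qed.

Lemma is_Cseries_plus (s t : nat -> C) (l m : C) :
  is_Cseries s l -> is_Cseries t m -> is_Cseries (fun n => s n + t n)%C (l + m)%C.
Proof.
intros [H1 H2] [H3 H4]; split.
- exact (is_series_plus _ _ _ _ H1 H3).
- exact (is_series_plus _ _ _ _ H2 H4).
Qed.

Lemma is_Cseries_scal (c : C) (t : nat -> C) (l : C) :
  is_Cseries t l -> is_Cseries (fun n => c * t n)%C (c * l)%C.
Proof.
intros [H1 H2]; split.
- exact (is_series_minus _ _ _ _ (is_series_scal (V := R_NormedModule) (fst c) _ _ H1)
   (is_series_scal (V := R_NormedModule) (snd c) _ _ H2)).
- exact (is_series_plus _ _ _ _ (is_series_scal (V := R_NormedModule) (fst c) _ _ H2)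
   (is_series_scal (V := R_NormedModule) (snd c) _ _ H1)).
Qed.

Lemma is_Cseries_decr (t : nat -> C) (l : C) :
  is_Cseries (fun n => t (S n)) l -> is_Cseries t (t 0%nat + l)%C.
Proof.
intros [H1 H2]; split.
- apply is_series_decr_1;   replace (plus _ _) with (Re l); [exact H1|].
  change (Re l = Re (t 0%nat + l) + - Re (t 0%nat)); simpl; unfold Re; ring.
- apply is_series_decr_1;   replace (plus _ _) with (Im l); [exact H2|].
  change (Im l = Im (t 0%nat + l) + - Im (t 0%nat)); simpl; unfold Im; ring.
Qed.

Lemma is_Cseries_ex (t : nat -> C) (b : nat -> R) :
  (forall n, Cmod (t n) <= b n) -> ex_series b -> exists l, is_Cseries t l.
Proof.
intros Hb H.
assert (Hr : ex_series (fun n => Re (t n))).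
{ apply (ex_series_le (V := R_CompleteNormedModule) _ b); [|exact H].
  intros n; exact (Rle_trans _ _ _ (re_le_Cmod _) (Hb n)). }
assert (Hi : ex_series (fun n => Im (t n))).
{ apply (ex_series_le (V := R_CompleteNormedModule) _ b); [|exact H].
  intros n; exact (Rle_trans _ _ _ (im_le_Cmod _) (Hb n)). }
destruct Hr as [x Hx], Hi as [y Hy]; exists (x, y); now split.
Qed.

Lemma is_series_abs_le (s b : nat -> R) (l : R) :
  (forall n, Rabs (s n) <= b n) -> ex_series b -> is_series s l ->
  Rabs l <= Series b.
Proof.
intros Hb H Hs; rewrite <- (is_series_unique _ _ Hs).
eapply Rle_trans; [apply Series_Rabs|].
- apply (ex_series_le (V := R_CompleteNormedModule) _ b); [|exact H].
  intros n; change (Rabs (Rabs (s n)) <= b n); rewrite Rabs_Rabsolu; apply Hb.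
- apply Series_le; [|exact H]; intros n; split; [apply Rabs_pos|apply Hb].
Qed.

Lemma is_Cseries_bound (t : nat -> C) (b : nat -> R) (l : C) :
  (forall n, Cmod (t n) <= b n) -> ex_series b -> is_Cseries t l ->
  Cmod l <= 2 * Series b.
Proof.
intros Hb H [H1 H2].
eapply Rle_trans; [apply Cmod_le_re_im|].
assert (Rabs (Re l) <= Series b).
{ apply (is_series_abs_le _ _ _ (fun n => Rle_trans _ _ _ (re_le_Cmod _) (Hb n)) H H1). }
assert (Rabs (Im l) <= Series b).
{ apply (is_series_abs_le _ _ _ (fun n => Rle_trans _ _ _ (im_le_Cmod _) (Hb n)) H H2). }
lra.
Qed.

Lemma bounded_prefix (w : nat -> R) (N : nat) :
  exists B, 0 <= B /\ forall n, (n <= N)%nat -> w n <= B.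
Proof.
induction N as [|N [B [HB H]]].
- exists (Rmax 0 (w 0%nat)); split; [apply Rmax_l|]; intros n Hn.
  replace n with 0%nat by lia; apply Rmax_r.
- exists (Rmax B (w (S N))); split; [eapply Rle_trans; [exact HB|apply Rmax_l]|].
  intros n Hn; destruct (Nat.eq_dec n (S N)) as [->|Hne]; [apply Rmax_r|].
  eapply Rle_trans; [apply H; lia|apply Rmax_l].
Qed.

Lemma subexp_ratio (w : nat -> C) :
  (forall q, 1 < q -> exists N, forall n, (N <= n)%nat ->
     Cmod (w (S n)) <= q * Cmod (w n)) -> subexp w.
Proof.
intros H q Hq; destruct (H q Hq) as [N HN].
destruct (bounded_prefix (fun n => Cmod (w n)) N) as [B [HB HBn]].
exists B; intros n; destruct (Nat.le_gt_cases n N) as [Hn|Hn].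
- specialize (HBn n Hn); generalize (pow_R1_Rle q n); simpl in *; nra.
- induction Hn as [|n Hn IH].
  + specialize (HN N (Nat.le_refl _)); specialize (HBn N (Nat.le_refl _)).
    assert (Cmod (w N) <= B * q ^ N) by (generalize (pow_R1_Rle q N); simpl in *; nra).
    simpl; nra.
  + specialize (HN n ltac:(lia)); simpl; nra.
Qed.

Lemma subexp_mult (u v : nat -> C) :
  subexp u -> subexp v -> subexp (fun n => u n * v n)%C.
Proof.
intros Hu Hv q Hq.
assert (Hs : 1 < sqrt q) by (rewrite <- sqrt_1; apply sqrt_lt_1_alt; lra).
destruct (Hu _ Hs) as [M HM], (Hv _ Hs) as [M' HM'].
exists (M * M'); intros n; rewrite Cmod_mult.
replace (M * M' * q ^ n) with ((M * sqrt q ^ n) * (M' * sqrt q ^ n)).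
- apply Rmult_le_compat; auto using Cmod_ge_0.
- rewrite <- (sqrt_sqrt q) at 3 by lra; rewrite Rpow_mult_distr; ring.
Qed.

Lemma subexp_ext (u v : nat -> C) : (forall n, u n = v n) -> subexp u -> subexp v.
Proof.
intros E H q Hq; destruct (H q Hq) as [M HM]; exists M; intros n; rewrite <- E; auto.
Qed.

Lemma subexp_shift (u : nat -> C) : subexp u -> subexp (fun n => u (S n)).
Proof.
intros H q Hq; destruct (H q Hq) as [M HM]; exists (M * q); intros n.
specialize (HM (S n)); simpl in HM; lra.
Qed.

Lemma subexp_unshift (u : nat -> C) : subexp (fun n => u (S n)) -> subexp u.
Proof.
intros H q Hq; destruct (H q Hq) as [M HM].
assert (HM0 : 0 <= M).
{ specialize (HM 0%nat); generalize (Cmod_ge_0 (u 1%nat)); simpl in HM; lra. }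
pose proof (Cmod_ge_0 (u 0%nat)) as H0.
exists (Cmod (u 0%nat) + M); intros [|n]; [simpl; lra|].
specialize (HM n); assert (Hp : 1 <= q ^ n) by (apply pow_R1_Rle; lra).
assert (0 <= (Cmod (u 0%nat) + M) * ((q - 1) * q ^ n)) by
  (apply Rmult_le_pos; [lra|apply Rmult_le_pos; lra]).
assert (0 <= Cmod (u 0%nat) * q ^ n) by (apply Rmult_le_pos; lra).
simpl; lra.
Qed.

Lemma archimed_nat (x : R) : exists N, forall n, (N <= n)%nat -> x <= INR n.
Proof.
destruct (INR_unbounded x) as [N HN]; exists N; intros n Hn.
apply le_INR in Hn; lra.
Qed.

Lemma poch_pos (x : R) (n : nat) : 0 < x -> 0 < poch x n.
Proof.
intros Hx; induction n as [|n IH]; simpl; [lra|].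
generalize (pos_INR n); intros; apply Rmult_lt_0_compat; lra.
Qed.

Lemma poch_1_fact (n : nat) : poch 1 n = INR (fact n).
Proof.
induction n as [|n IH]; [reflexivity|].
rewrite fact_simpl, mult_INR, <- IH, S_INR; simpl poch; ring.
Qed.

(** The coefficients of 2F1, their reciprocals and, up to sign, the binomial coefficients are all
    products of such ratios. The binomial case takes a negative [x]. *)
Lemma subexp_poch (x y : R) : 0 < y ->
  subexp (fun n => RtoC (poch x n / poch y n)).
Proof.
intros Hy; apply subexp_ratio; intros q Hq.
destruct (archimed_nat (Rabs x / (q - 1))) as [N HN]; exists N; intros n Hn.
specialize (HN n Hn).
apply (Rmult_le_compat_r (q - 1)) in HN; [|lra].
unfold Rdiv in HN; rewrite Rmult_assoc, Rinv_l in HN by lra.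
rewrite !Cmod_R; simpl poch.
pose proof (poch_pos y n Hy) as Hp; pose proof (pos_INR n) as Hn0.
replace (poch x n * (x + INR n) / (poch y n * (y + INR n)))
  with ((x + INR n) / (y + INR n) * (poch x n / poch y n)) by (field; lra).
rewrite Rabs_mult; apply Rmult_le_compat_r; [apply Rabs_pos|].
unfold Rdiv; rewrite Rabs_mult, Rabs_inv, (Rabs_pos_eq (y + INR n)) by lra.
apply (Rmult_le_reg_r (y + INR n)); [lra|].
rewrite Rmult_assoc, Rinv_l by lra.
generalize (Rabs_triang x (INR n)); rewrite (Rabs_pos_eq (INR n)) by lra; nra.
Qed.

Lemma subexp_INR : subexp (fun n => RtoC (INR n)).
Proof.
apply subexp_ratio; intros q Hq.
destruct (archimed_nat (1 / (q - 1))) as [N HN]; exists N; intros n Hn.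
specialize (HN n Hn).
apply (Rmult_le_compat_r (q - 1)) in HN; [|lra].
unfold Rdiv in HN; rewrite Rmult_assoc, Rinv_l in HN by lra.
rewrite !Cmod_R, !Rabs_pos_eq by apply pos_INR; rewrite S_INR; lra.
Qed.

Lemma subexp_summable (u : nat -> C) (r : R) : subexp u -> 0 <= r < 1 ->
  ex_series (fun n => Cmod (u n) * r ^ n).
Proof.
intros Hu Hr.
(* [q = 2 / (1 + r)] exceeds 1 while [q * r] stays below 1, which leaves a convergent geometric
   majorant. *)
assert (Hq : 1 < 2 / (1 + r)).
{ apply (Rmult_lt_reg_r (1 + r)); [lra|]; unfold Rdiv; rewrite Rmult_assoc, Rinv_l; lra. }
destruct (Hu _ Hq) as [M HM].
assert (Hqr : 0 <= 2 / (1 + r) * r < 1).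
{ split; [apply Rmult_le_pos; lra|].
  apply (Rmult_lt_reg_r (1 + r)); [lra|].
  replace (2 / (1 + r) * r * (1 + r)) with (2 * r) by (field; lra); lra. }
apply (ex_series_le (V := R_CompleteNormedModule) _
  (fun n => M * (2 / (1 + r) * r) ^ n)).
- intros n; change (Rabs (Cmod (u n) * r ^ n) <= M * (2 / (1 + r) * r) ^ n).
  rewrite Rabs_pos_eq by (apply Rmult_le_pos; [apply Cmod_ge_0|apply pow_le; lra]).
  rewrite Rpow_mult_distr, <- Rmult_assoc.
  apply Rmult_le_compat_r; [apply pow_le; lra|apply HM].
- eexists; apply (is_series_scal (V := R_NormedModule)), is_series_geom.
  rewrite Rabs_pos_eq; lra.
Qed.

Lemma term_bound (u : nat -> C) (z : C) (r : R) (n : nat) :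
  Cmod z <= r -> Cmod (u n * z ^ n)%C <= Cmod (u n) * r ^ n.
Proof.
intros H; rewrite Cmod_mult, Cmod_pow.
apply Rmult_le_compat_l; [apply Cmod_ge_0|]; apply pow_incr.
split; [apply Cmod_ge_0|exact H].
Qed.

Lemma CPSeries_correct (u : nat -> C) (z : C) : subexp u -> Cmod z < 1 ->
  is_Cseries (fun n => u n * z ^ n)%C (CPSeries u z).
Proof.
intros Hu Hz.
destruct (is_Cseries_ex (fun n => u n * z ^ n)%C (fun n => Cmod (u n) * Cmod z ^ n))
  as [l Hl].
- intros n; apply term_bound, Rle_refl.
- apply subexp_summable; [exact Hu|]; split; [apply Cmod_ge_0|exact Hz].
- now rewrite (CPSeries_is_Cseries _ _ _ Hl).
Qed.

Lemma CPSeries_bounded (u : nat -> C) (r : R) : subexp u -> 0 <= r < 1 ->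
  exists B, forall z, Cmod z <= r -> Cmod (CPSeries u z) <= B.
Proof.
intros Hu Hr; exists (2 * Series (fun n => Cmod (u n) * r ^ n)); intros z Hz.
apply is_Cseries_bound with (t := fun n => (u n * z ^ n)%C).
- intros n; now apply term_bound.
- now apply subexp_summable.
- apply CPSeries_correct; [exact Hu|lra].
Qed.

Lemma CPSeries_step (u : nat -> C) (z : C) : subexp u -> Cmod z < 1 ->
  CPSeries u z = (u 0%nat + z * CPSeries (fun n => u (S n)) z)%C.
Proof.
intros Hu Hz; apply CPSeries_is_Cseries.
replace (u 0%nat) with (u 0%nat * z ^ 0)%C by (simpl; ring).
apply (is_Cseries_decr (fun n => u n * z ^ n)%C).
eapply is_Cseries_ext; [|apply is_Cseries_scal, CPSeries_correct;
  [apply subexp_shift, Hu|exact Hz]].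
intros n; simpl; ring.
Qed.

Lemma CPSeries_0 (u : nat -> C) : subexp u -> CPSeries u 0 = u 0%nat.
Proof.
intros Hu; rewrite CPSeries_step; [ring|exact Hu|rewrite Cmod_0; lra].
Qed.

Lemma CPSeries_ext (u v : nat -> C) (z : C) :
  (forall n, u n = v n) -> CPSeries u z = CPSeries v z.
Proof.
intros E; unfold CPSeries; f_equal; apply Series_ext; intros n; now rewrite E.
Qed.

Lemma CPSeries_plus (u v : nat -> C) (z : C) : subexp u -> subexp v -> Cmod z < 1 ->
  CPSeries (fun n => u n + v n)%C z = (CPSeries u z + CPSeries v z)%C.
Proof.
intros Hu Hv Hz; apply CPSeries_is_Cseries.
eapply is_Cseries_ext; [|apply is_Cseries_plus; apply CPSeries_correct; eassumption].
intros n; simpl; ring.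
Qed.

Lemma CPSeries_scal (c : C) (u : nat -> C) (z : C) : subexp u -> Cmod z < 1 ->
  CPSeries (fun n => c * u n)%C z = (c * CPSeries u z)%C.
Proof.
intros Hu Hz; apply CPSeries_is_Cseries.
eapply is_Cseries_ext; [|apply is_Cseries_scal, CPSeries_correct; eassumption].
intros n; simpl; ring.
Qed.

Definition dcoef (u : nat -> C) (n : nat) : C := (RtoC (INR (S n)) * u (S n))%C.

Lemma subexp_dcoef (u : nat -> C) : subexp u -> subexp (dcoef u).
Proof.
intros Hu; apply (subexp_shift (fun n => RtoC (INR n) * u n)%C).
apply subexp_mult; [apply subexp_INR|exact Hu].
Qed.

(** Second-order Taylor remainder of a power. The factor [r * r] on the left avoids the exponent n -
    2. With E_n the remainder, the induction uses E_(n+1) = y E_n + n z^(n-1) (y - z)^2. *)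
Lemma pow_second_order (y z : C) (r : R) (n : nat) : Cmod y <= r -> Cmod z <= r ->
  r * r * Cmod (y ^ n - z ^ n - RtoC (INR n) * z ^ pred n * (y - z))%C
    <= INR n * INR n * r ^ n * (Cmod (y - z) * Cmod (y - z)).
Proof.
intros Hy Hz; pose proof (Cmod_ge_0 y) as Hy0.
induction n as [|n IH].
- simpl INR; replace (y ^ 0 - z ^ 0 - 0 * z ^ pred 0 * (y - z))%C with (RtoC 0)
    by (simpl; ring); rewrite Cmod_0; lra.
- set (E := (y ^ n - z ^ n - RtoC (INR n) * z ^ pred n * (y - z))%C) in IH.
  replace (y ^ S n - z ^ S n - RtoC (INR (S n)) * z ^ pred (S n) * (y - z))%C
    with (y * E + RtoC (INR n) * z ^ pred n * ((y - z) * (y - z)))%C.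
  2:{ unfold E; rewrite S_INR, RtoC_plus; destruct n as [|n]; simpl; ring. }
  set (h := Cmod (y - z)) in *.
  assert (Hh : 0 <= h) by apply Cmod_ge_0.
  pose proof (pos_INR n) as Hn.
  assert (H1 : Cmod (RtoC (INR n) * z ^ pred n * ((y - z) * (y - z)))%C
     <= INR n * r ^ pred n * (h * h)).
  { rewrite !Cmod_mult, Cmod_R, Cmod_pow, Rabs_pos_eq by assumption.
    apply Rmult_le_compat_r; [nra|]; apply Rmult_le_compat_l; [assumption|].
    apply pow_incr; split; [apply Cmod_ge_0|exact Hz]. }
  assert (H2 : INR n * (r * r * r ^ pred n) = INR n * r ^ S n).
  { destruct n as [|n]; simpl; [ring|]; ring. }
  pose proof (Cmod_triangle (y * E)
    (RtoC (INR n) * z ^ pred n * ((y - z) * (y - z)))) as H3.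
  rewrite Cmod_mult in H3.
  assert (Hr : 0 <= r) by lra.
  assert (H4 : Cmod y * Cmod E <= r * Cmod E)
    by (apply Rmult_le_compat_r; [apply Cmod_ge_0|exact Hy]).
  assert (Hrr : 0 <= r * r) by nra.
  eapply Rle_trans.
  { apply Rmult_le_compat_l; [exact Hrr|].
    eapply Rle_trans; [exact H3|]; apply Rplus_le_compat; [exact H4|exact H1]. }
  apply (Rmult_le_compat_l r) in IH; [|exact Hr].
  assert (Hrn : 0 <= r ^ S n) by (apply pow_le; exact Hr).
  replace (r * r * (r * Cmod E + INR n * r ^ pred n * (h * h)))
    with (r * (r * r * Cmod E) + (INR n * (r * r * r ^ pred n)) * (h * h)) by ring.
  rewrite H2.
  eapply Rle_trans; [apply Rplus_le_compat_r, IH|].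
  rewrite S_INR.
  replace (r * (INR n * INR n * r ^ n * (h * h)) + INR n * r ^ S n * (h * h))
    with ((INR n * INR n + INR n) * (r ^ S n * (h * h))) by (simpl; ring).
  replace ((INR n + 1) * (INR n + 1) * r ^ S n * (h * h))
    with ((INR n + 1) * (INR n + 1) * (r ^ S n * (h * h))) by ring.
  apply Rmult_le_compat_r; [apply Rmult_le_pos; nra|nra].
Qed.

(** Summing [pow_second_order] bounds the remainder by a constant times |y - z|^2. The constant is
    finite because n^2 u_n is again subexponential and [r] lies strictly between |z| and 1. *)
Lemma CPSeries_cder (u : nat -> C) (z : C) : subexp u -> Cmod z < 1 ->
  cder (CPSeries u) z (CPSeries (dcoef u) z).
Proof.
intros Hu Hz eps Heps.
pose proof (Cmod_ge_0 z) as Hz0.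
assert (Hm1 : RtoC (-1) = (- (1))%C) by (apply injective_projections; simpl; ring).
set (r := (1 + Cmod z) / 2).
assert (Hr : 0 < r < 1) by (unfold r; lra).
assert (Hzr : Cmod z < r) by (unfold r; lra).
set (v := fun n => (RtoC (INR n) * RtoC (INR n) * u n)%C).
assert (Hv : subexp v).
{ apply subexp_mult; [apply subexp_mult; apply subexp_INR|exact Hu]. }
assert (Hex := subexp_summable v r Hv ltac:(lra)).
set (S := Series (fun n => Cmod (v n) * r ^ n)).
assert (HS : 0 <= S).
{ unfold S; rewrite <- (Rmult_0_l (Series (fun n => Cmod (v n) * r ^ n))).
  rewrite <- Series_scal_l; apply Series_le; [|exact Hex]; intros n.
  assert (0 <= Cmod (v n) * r ^ n)
    by (apply Rmult_le_pos; [apply Cmod_ge_0|apply pow_le; lra]); lra. }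
set (Q := 2 * (S / (r * r))).
assert (HQ : 0 <= Q).
{ unfold Q, Rdiv; assert (0 < / (r * r)) by (apply Rinv_0_lt_compat; nra); nra. }
exists (Rmin (r - Cmod z) (eps / (Q + 1))); split.
{ apply Rmin_pos; [lra|apply Rdiv_lt_0_compat; lra]. }
intros y Hy.
assert (Hy1 : Cmod (y - z) < r - Cmod z) by (eapply Rlt_le_trans; [exact Hy|apply Rmin_l]).
assert (Hy2 : Cmod (y - z) < eps / (Q + 1)) by (eapply Rlt_le_trans; [exact Hy|apply Rmin_r]).
assert (Hyr : Cmod y <= r).
{ generalize (Cmod_triangle_rev y z); lra. }
(* The derivative series is reindexed with a vanishing zeroth term, so that it aligns termwise with
   the two series for [u]. *)
assert (Hd : is_Cseries (fun n => RtoC (INR n) * u n * z ^ pred n)%C (CPSeries (dcoef u) z)).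
{ replace (CPSeries (dcoef u) z)
    with (RtoC (INR 0) * u 0%nat * z ^ pred 0 + CPSeries (dcoef u) z)%C
    by (simpl INR; ring).
  apply (is_Cseries_decr (fun n => RtoC (INR n) * u n * z ^ pred n)%C).
  apply CPSeries_correct; [apply subexp_dcoef, Hu|exact Hz]. }
assert (HE := is_Cseries_plus _ _ _ _
  (is_Cseries_plus _ _ _ _ (CPSeries_correct u y Hu ltac:(lra))
    (is_Cseries_scal (RtoC (-1)) _ _ (CPSeries_correct u z Hu Hz)))
  (is_Cseries_scal (- (y - z))%C _ _ Hd)); cbv beta in HE.
replace (CPSeries u y - CPSeries u z - CPSeries (dcoef u) z * (y - z))%C
  with (CPSeries u y + RtoC (-1) * CPSeries u z + - (y - z) * CPSeries (dcoef u) z)%C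
  by (rewrite Hm1; ring).
set (h := Cmod (y - z)) in *; assert (Hh : 0 <= h) by apply Cmod_ge_0.
assert (Hbd : Cmod (CPSeries u y + RtoC (-1) * CPSeries u z
    + - (y - z) * CPSeries (dcoef u) z)%C
  <= 2 * Series (fun n => (h * h / (r * r)) * (Cmod (v n) * r ^ n))).
{ eapply is_Cseries_bound; [| |exact HE].
  - intros n; cbv beta.
    replace (u n * y ^ n + RtoC (-1) * (u n * z ^ n)
       + - (y - z) * (RtoC (INR n) * u n * z ^ pred n))%C
      with (u n * (y ^ n - z ^ n - RtoC (INR n) * z ^ pred n * (y - z)))%C
      by (rewrite Hm1; ring).
    assert (Ev : Cmod (v n) = INR n * INR n * Cmod (u n)).
    { unfold v; rewrite !Cmod_mult, !Cmod_R, !Rabs_pos_eq by apply pos_INR; reflexivity. }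
    rewrite Cmod_mult, Ev.
    assert (H2 := pow_second_order y z r n Hyr ltac:(lra)); fold h in H2.
    apply (Rmult_le_reg_l (r * r)); [nra|].
    replace (r * r * (h * h / (r * r) * (INR n * INR n * Cmod (u n) * r ^ n)))
      with (Cmod (u n) * (INR n * INR n * r ^ n * (h * h))) by (field; lra).
    rewrite (Rmult_comm (Cmod (u n))), <- Rmult_assoc, Rmult_comm.
    apply Rmult_le_compat_l; [apply Cmod_ge_0|exact H2].
  - apply (ex_series_scal (V := R_NormedModule)); exact Hex. }
rewrite Series_scal_l in Hbd; fold S in Hbd.
replace (2 * (h * h / (r * r) * S)) with (Q * h * h) in Hbd by (unfold Q; field; lra).
eapply Rle_trans; [exact Hbd|]; apply Rmult_le_compat_r; [exact Hh|].
apply (Rmult_lt_compat_r (Q + 1)) in Hy2; [|lra].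
unfold Rdiv in Hy2; rewrite Rmult_assoc, Rinv_l in Hy2 by lra; nra.
Qed.

(** * Exponential and logarithms of zero-free functions *)


Lemma Cexp_0 : Cexp 0 = 1%C.
Proof. unfold Cexp; simpl; rewrite exp_0, cos_0, sin_0, Rmult_0_r, Rmult_1_r; reflexivity. Qed.

Lemma Cexp_plus (y z : C) : Cexp (y + z) = (Cexp y * Cexp z)%C.
Proof.
unfold Cexp; simpl; rewrite exp_plus, cos_plus, sin_plus.
apply injective_projections; simpl; unfold Re, Im; ring.
Qed.

Lemma Cmod_Cexp (z : C) : Cmod (Cexp z) = exp (Re z).
Proof.
unfold Cmod, Cexp; simpl fst; simpl snd.
replace ((exp (Re z) * cos (Im z)) ^ 2 + (exp (Re z) * sin (Im z)) ^ 2)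
  with (Rsqr (exp (Re z)) * (Rsqr (sin (Im z)) + Rsqr (cos (Im z)))) by (unfold Rsqr; ring).
rewrite sin2_cos2, Rmult_1_r, sqrt_Rsqr; [reflexivity|left; apply exp_pos].
Qed.

Lemma Cexp_neq_0 (z : C) : Cexp z <> 0%C.
Proof. apply Cmod_gt_0; rewrite Cmod_Cexp; apply exp_pos. Qed.

Lemma derivable_pt_lim_bound_0 (f : R -> R) (l : R) : derivable_pt_lim f 0 l ->
  forall eps, 0 < eps -> exists d, 0 < d /\ forall h, Rabs h < d ->
    Rabs (f h - f 0 - l * h) <= eps * Rabs h.
Proof.
intros H eps Heps; destruct (H eps Heps) as [d Hd].
exists d; split; [apply cond_pos|]; intros h Hh.
destruct (Req_dec h 0) as [->|Hh0].
- rewrite Rabs_R0; replace (f 0 - f 0 - l * 0) with 0 by ring; rewrite Rabs_R0; lra.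
- specialize (Hd h Hh0 Hh); rewrite Rplus_0_l in Hd.
  replace (f h - f 0 - l * h) with (((f h - f 0) / h - l) * h) by (field; assumption).
  rewrite Rabs_mult; apply Rmult_le_compat_r; [apply Rabs_pos|lra].
Qed.

Lemma Cexp_cder_0 : cder Cexp 0 1.
Proof.
(* The two components of the remainder will be at most [4 * (e * m)] and [5 * (e * m)], [m] being
   the modulus of the increment. *)
intros eps Heps; set (e := Rmin 1 (eps / 10)).
assert (He : 0 < e) by (apply Rmin_pos; lra).
assert (He1 : e <= 1) by apply Rmin_l.
assert (He2 : e <= eps / 10) by apply Rmin_r.
clearbody e.
destruct (derivable_pt_lim_bound_0 exp 1) with (eps := e) as [d1 [Hd1 H1]]; auto.
{ rewrite <- exp_0; apply derivable_pt_lim_exp. }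
destruct (derivable_pt_lim_bound_0 cos 0) with (eps := e) as [d2 [Hd2 H2]]; auto.
{ replace 0 with (- sin 0) at 2 by (rewrite sin_0; ring); apply derivable_pt_lim_cos. }
destruct (derivable_pt_lim_bound_0 sin 1) with (eps := e) as [d3 [Hd3 H3]]; auto.
{ rewrite <- cos_0; apply derivable_pt_lim_sin. }
exists (Rmin e (Rmin d1 (Rmin d2 d3))); split; [repeat apply Rmin_pos; assumption|].
intros z; replace (z - 0)%C with z by ring; intros Hz.
assert (Hz0 : Cmod z < e) by (eapply Rlt_le_trans; [exact Hz|apply Rmin_l]).
apply Rlt_le_trans with (2 := Rmin_r _ _) in Hz.
assert (Hz1 : Cmod z < d1) by (eapply Rlt_le_trans; [exact Hz|apply Rmin_l]).
apply Rlt_le_trans with (2 := Rmin_r _ _) in Hz.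
assert (Hz2 : Cmod z < d2) by (eapply Rlt_le_trans; [exact Hz|apply Rmin_l]).
assert (Hz3 : Cmod z < d3) by (eapply Rlt_le_trans; [exact Hz|apply Rmin_r]).
rewrite Cexp_0; pose proof (re_le_Cmod z) as Hx; pose proof (im_le_Cmod z) as Hy.
destruct z as [x y]; simpl Re in Hx; simpl Im in Hy.
specialize (H1 x ltac:(simpl in Hx; lra)); specialize (H2 y ltac:(simpl in Hy; lra));
specialize (H3 y ltac:(simpl in Hy; lra)).
rewrite exp_0 in H1; rewrite cos_0 in H2; rewrite sin_0 in H3.
set (m := Cmod (x, y)) in *; simpl in Hx, Hy.
set (A := exp x - 1 - 1 * x) in *; set (B := cos y - 1 - 0 * y) in *;
set (D := sin y - 0 - 1 * y) in *.
pose proof (Rabs_pos x); pose proof (Rabs_pos y).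
assert (HA : Rabs A <= e * m) by nra.
assert (HB : Rabs B <= e * m) by nra.
assert (HD : Rabs D <= e * m) by nra.
(* Substituting exp x = 1 + x + A, cos y = 1 + B and sin y = y + D leaves only terms that contain a
   remainder or a product of two small quantities. *)
replace (Cexp (x, y) - 1 - 1 * (x, y))%C
  with (A * (1 + B) + (1 + x) * B, (1 + x + A) * D + (x + A) * y).
2:{ unfold Cexp, A, B, D; apply injective_projections; simpl; ring. }
eapply Rle_trans; [apply Cmod_le_re_im|]; simpl.
assert (em : e * m <= 1) by nra.
apply Rabs_le_between in HA; apply Rabs_le_between in HB; apply Rabs_le_between in HD.
apply Rabs_le_between in Hx; apply Rabs_le_between in Hy.
assert (T : forall a b c d, -c <= a <= c -> - d <= b <= d -> - (c * d) <= a * b <= c * d).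
{ intros a b c' d Ha Hb; apply Rabs_le_between; rewrite Rabs_mult.
  apply Rmult_le_compat; try apply Rabs_pos; apply Rabs_le_between; assumption. }
assert (Hm0 : 0 <= m) by apply Cmod_ge_0.
pose proof (T A (1 + B) (e * m) 2 HA ltac:(lra)).
pose proof (T (1 + x) B 2 (e * m) ltac:(lra) HB).
pose proof (T (1 + x + A) D 3 (e * m) ltac:(lra) HD).
pose proof (T (x + A) y (2 * e) m ltac:(nra) Hy).
assert (Rabs (A * (1 + B) + (1 + x) * B) <= 4 * (e * m)) by (apply Rabs_le_between; lra).
assert (Rabs ((1 + x + A) * D + (x + A) * y) <= 5 * (e * m)) by (apply Rabs_le_between; lra).
assert (e * m <= eps / 10 * m) by (apply Rmult_le_compat_r; assumption).
lra.
Qed.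

Lemma Cexp_cder (z : C) : cder Cexp z (Cexp z).
Proof.
apply (cder_ext (fun y => Cexp z * Cexp (y - z))%C _ _ _ 1 Rlt_0_1).
{ intros y _; rewrite <- Cexp_plus; f_equal; ring. }
apply (cder_eq _ _ (Cexp z * (1 * 1))%C); [|ring].
apply cder_scal, (cder_comp Cexp (fun y => y - z)%C).
- replace (z - z)%C with (RtoC 0) by ring; apply Cexp_cder_0.
- apply (cder_eq _ _ (1 - 0)%C); [|ring].
  apply cder_minus; [apply cder_id|apply cder_const].
Qed.

Lemma cder_Cexp (f : C -> C) (z l : C) : cder f z l ->
  cder (fun y => Cexp (f y)) z (l * Cexp (f z)).
Proof. intros H; apply (cder_comp Cexp f); [apply Cexp_cder|exact H]. Qed.

Definition log1p_coef (n : nat) : C :=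
  match n with O => RtoC 0 | S k => RtoC ((-1) ^ k / INR (S k)) end.

Lemma subexp_log1p : subexp log1p_coef.
Proof.
apply subexp_unshift, subexp_ratio; intros q Hq; exists 0%nat; intros n _.
unfold log1p_coef; rewrite !Cmod_R; unfold Rdiv; rewrite !Rabs_mult, <- !RPow_abs.
replace (Rabs (-1)) with 1 by (rewrite Rabs_left; lra).
rewrite !pow1, !Rmult_1_l, !Rabs_inv, !Rabs_pos_eq by apply pos_INR.
assert (H : 0 < INR (S n)) by (apply lt_0_INR; lia).
assert (/ INR (S (S n)) <= / INR (S n)) by
  (apply Rinv_le_contravar; [exact H|apply le_INR; lia]).
generalize (Rinv_0_lt_compat _ H); nra.
Qed.

Definition Log1p (w : C) : C := CPSeries log1p_coef w.

Lemma one_plus_neq_0 (w : C) : Cmod w < 1 -> (1 + w)%C <> 0%C.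
Proof.
intros Hw E; assert (Ew : w = (- (1))%C)
  by (replace w with (1 + w - 1)%C by ring; rewrite E; ring).
rewrite Ew, Cmod_m1 in Hw; lra.
Qed.

Lemma Log1p_0 : Log1p 0 = 0%C.
Proof. unfold Log1p; now rewrite CPSeries_0 by apply subexp_log1p. Qed.

(** The differentiated series is geometric; its sum [S] satisfies S = 1 - w S, which identifies it
    without a limit of partial sums. *)
Lemma Log1p_cder (w : C) : Cmod w < 1 -> cder Log1p w (/ (1 + w)).
Proof.
intros Hw.
eapply cder_eq; [exact (CPSeries_cder _ w subexp_log1p Hw)|].
rewrite (CPSeries_ext _ (fun n => RtoC ((-1) ^ n))).
2:{ intros n; unfold dcoef, log1p_coef; rewrite <- RtoC_mult; f_equal.
  field; apply not_0_INR; lia. }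
set (S := CPSeries (fun n => RtoC ((-1) ^ n)) w).
assert (Hg : subexp (fun n => RtoC ((-1) ^ n))).
{ intros q Hq; exists 1; intros n; rewrite Cmod_R, <- RPow_abs.
  replace (Rabs (-1)) with 1 by (rewrite Rabs_left; lra).
  rewrite pow1; generalize (pow_R1_Rle q n); lra. }
assert (E : S = (1 - w * S)%C).
{ unfold S at 1; rewrite CPSeries_step by assumption.
  rewrite (CPSeries_ext _ (fun n => RtoC (-1) * RtoC ((-1) ^ n))%C).
  - rewrite CPSeries_scal by assumption; fold S; simpl.
    apply injective_projections; simpl; ring.
  - intros n; rewrite <- RtoC_mult; reflexivity. }
pose proof (one_plus_neq_0 w Hw) as H0.
assert (E' : (S * (1 + w) = 1)%C).
{ replace (S * (1 + w))%C with (S + w * S)%C by ring; rewrite E at 1; ring. }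
replace S with (S * (1 + w) * / (1 + w))%C by (field; exact H0).
rewrite E'; ring.
Qed.

Lemma Cexp_Log1p (w : C) : Cmod w < 1 -> Cexp (Log1p w) = (1 + w)%C.
Proof.
intros Hw; pose proof (one_plus_neq_0 w Hw) as H0.
assert (E : (Cexp (Log1p w) * / (1 + w) = Cexp (Log1p 0) * / (1 + 0))%C).
{ apply (cder_zero_const (fun w => Cexp (Log1p w) * / (1 + w))%C 1); [|exact Hw].
  intros z Hz; pose proof (one_plus_neq_0 z Hz) as Hz0.
  eapply cder_eq.
  - apply cder_mult; [apply cder_Cexp, Log1p_cder, Hz|].
    apply (cder_inv (fun y => 1 + y)%C); [exact Hz0|].
    apply cder_plus; [apply cder_const|apply cder_id].
  - cbv beta; field; exact Hz0. }
replace (Cexp (Log1p w)) with (Cexp (Log1p w) * / (1 + w) * (1 + w))%C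
  by (field; exact H0).
rewrite E, Log1p_0, Cexp_0; field; intros H; apply RtoC_inj in H; lra.
Qed.

(** Recording the derivative beside the exponential identity makes [L] unique on the disk, and
    uniqueness is what permits gluing. *)
Definition is_log (Q Q1 L : C -> C) (r : R) : Prop :=
  L 0%C = 0%C /\
  forall z, Cmod z < r -> cder L z (Q1 z / Q z)%C /\ Cexp (L z) = Q z.

(** A logarithm of [Q] is corrected by the logarithm of the ratio T / Q, which is close enough to 1
    for the power series [Log1p]; no branch has to be chosen. *)
Lemma is_log_step (Q Q1 T T1 L : C -> C) (r : R) : 0 < r ->
  is_log Q Q1 L r ->
  (forall z, Cmod z < r -> cder Q z (Q1 z) /\ Q z <> 0%C) ->
  (forall z, Cmod z < r -> cder T z (T1 z) /\ T z <> 0%C) ->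
  T 0%C = Q 0%C -> (forall z, Cmod z < r -> Cmod (T z / Q z - 1)%C < 1) ->
  is_log T T1 (fun z => L z + Log1p (T z / Q z - 1))%C r.
Proof.
intros Hr [L0 HL] HQ HT E0 Hclose; split.
- rewrite E0, L0; replace (Q 0 / Q 0 - 1)%C with (RtoC 0); [rewrite Log1p_0; ring|].
  field; apply HQ; rewrite Cmod_0; exact Hr.
- intros z Hz; destruct (HL z Hz) as [H1 H2], (HQ z Hz) as [H3 H4],
    (HT z Hz) as [H5 H6]; split.
  + eapply cder_eq.
    * apply cder_plus; [exact H1|].
      apply (cder_comp Log1p (fun z => T z / Q z - 1)%C);
        [apply Log1p_cder, Hclose, Hz|].
      apply cder_minus; [|apply cder_const].
      apply cder_mult; [exact H5|apply cder_inv; [exact H4|exact H3]].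
    * cbv beta.
      replace (1 + (T z / Q z - 1))%C with (T z / Q z)%C by ring.
      field; now split.
  + rewrite Cexp_plus, H2, Cexp_Log1p by (apply Hclose, Hz); field; exact H4.
Qed.

Lemma disk_attains_max (f : C -> R) (r : R) : 0 <= r ->
  (forall z eps, Cmod z <= r -> 0 < eps -> exists d, 0 < d /\
     forall y, Cmod y <= r -> Cmod (y - z) < d -> f y < f z + eps) ->
  exists z, Cmod z <= r /\ forall y, Cmod y <= r -> f y <= f z.
Proof.
intros Hr; apply (usc_attains_max (fun z => Cmod z <= r) f r 0%C).
- rewrite Cmod_0; exact Hr.
- auto.
- intros z Hz; exists (Cmod z - r); split; [lra|]; intros y Hy.
  generalize (Cmod_triangle_rev z y); rewrite (Cmod_minus_sym z y); lra.
Qed.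

Lemma cder_disk_max_Cmod (f : C -> C) (r : R) : 0 <= r ->
  (forall z, Cmod z <= r -> exists l, cder f z l) ->
  exists z, Cmod z <= r /\ forall y, Cmod y <= r -> Cmod (f y) <= Cmod (f z).
Proof.
intros Hr Hf; apply (disk_attains_max (fun z => Cmod (f z)) r Hr).
intros z eps Hz Heps; destruct (Hf z Hz) as [l Hl].
destruct (cder_cont f z l eps Hl Heps) as [d [Hd H]].
exists d; split; [exact Hd|]; intros y _ Hy; specialize (H y Hy).
generalize (Cmod_triangle_rev (f y) (f z)); lra.
Qed.

Lemma cder_disk_min_Cmod (f : C -> C) (r : R) : 0 <= r ->
  (forall z, Cmod z <= r -> exists l, cder f z l) ->
  exists z, Cmod z <= r /\ forall y, Cmod y <= r -> Cmod (f z) <= Cmod (f y).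
Proof.
intros Hr Hf.
destruct (disk_attains_max (fun z => - Cmod (f z)) r Hr) as [z [Hz H]].
- intros z eps Hz Heps; destruct (Hf z Hz) as [l Hl].
  destruct (cder_cont f z l eps Hl Heps) as [d [Hd H]].
  exists d; split; [exact Hd|]; intros y _ Hy; specialize (H y Hy).
  generalize (Cmod_triangle_rev (f z) (f y)); rewrite (Cmod_minus_sym (f z)); lra.
- exists z; split; [exact Hz|]; intros y Hy; specialize (H y Hy); lra.
Qed.

(** The dilations P(t z), with t running through k / N, lead from the constant 1 to [P]. Since |P|
    >= m > 0 and |P'| <= B on the closed disk, consecutive dilations have a ratio close to 1 once N
    is large, and [is_log_step] applies N times. *)
Lemma log_exists_smaller_disk (P P1 : C -> C) (R0 r : R) : 0 < r < R0 ->
  (forall z, Cmod z < R0 -> cder P z (P1 z)) ->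
  (forall z, Cmod z < R0 -> exists l, cder P1 z l) ->
  (forall z, Cmod z < R0 -> P z <> 0%C) -> P 0%C = 1%C ->
  exists L, is_log P P1 L r.
Proof.
intros Hr HP HP1 Hnz HP0.
destruct (cder_disk_max_Cmod P1 r) as [zB [_ HB]]; [lra|intros z Hz; apply HP1; lra|].
set (B := Cmod (P1 zB)) in HB.
destruct (cder_disk_min_Cmod P r) as [zm [Hzm Hm]];
  [lra|intros z Hz; exists (P1 z); apply HP; lra|].
set (m := Cmod (P zm)) in Hm.
assert (Hm0 : 0 < m) by (apply Cmod_gt_0, Hnz; lra).
assert (HB0 : 0 <= B) by apply Cmod_ge_0.
(* One step of the dilation moves the value by at most 2 B r / N, by [cder_mean_value]; this must be
   less than [m]. *)
destruct (archimed_nat (2 * B * r / m + 1)) as [N HN].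
specialize (HN N (Nat.le_refl _)).
assert (HNp : 2 * B * r < INR N * m).
{ apply (Rmult_le_compat_r m) in HN; [|lra].
  unfold Rdiv in HN; rewrite Rmult_plus_distr_r, Rmult_assoc, Rinv_l in HN; lra. }
assert (HN0 : 0 < INR N) by (assert (0 <= 2 * B * r) by nra; nra).
set (t := fun k : nat => INR k / INR N).
assert (Ht : forall k, (k <= N)%nat -> 0 <= t k <= 1).
{ intros k Hk; apply le_INR in Hk; pose proof (pos_INR k); unfold t; split.
  - apply Rmult_le_pos; [assumption|left; now apply Rinv_0_lt_compat].
  - apply (Rmult_le_reg_r (INR N)); [assumption|].
    unfold Rdiv; rewrite Rmult_assoc, Rinv_l; lra. }
assert (Hin : forall s z, 0 <= s <= 1 -> Cmod (s * z)%C <= Cmod z).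
{ intros s z Hs; rewrite Cmod_mult, Cmod_R, Rabs_pos_eq by lra.
  generalize (Cmod_ge_0 z); nra. }
assert (Hdil : forall k z, (k <= N)%nat -> Cmod z < r ->
  cder (fun z => P (t k * z)%C) z (t k * P1 (t k * z))%C /\ P (t k * z)%C <> 0%C).
{ intros k z Hk Hz; specialize (Hin (t k) z (Ht k Hk)); split; [|apply Hnz; lra].
  apply (cder_comp P); [apply HP; lra|].
  apply (cder_eq _ _ (t k * 1)%C); [apply cder_scal, cder_id|ring]. }
assert (Hk : forall k, (k <= N)%nat ->
  exists L, is_log (fun z => P (t k * z)%C) (fun z => t k * P1 (t k * z))%C L r).
{ induction k as [|k IH]; intros Hk.
  - exists (fun _ => 0%C); split; [reflexivity|]; intros z Hz.
    assert (Et : t 0%nat = 0) by (unfold t; simpl; field; lra).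
    rewrite Et; replace (0 * z)%C with (RtoC 0) by ring; rewrite HP0, Cexp_0.
    split; [|reflexivity].
    eapply cder_eq; [apply cder_const|]; field; intros H; apply RtoC_inj in H; lra.
  - destruct IH as [L HL]; [lia|]; eexists.
    refine (is_log_step _ _ _ _ L r _ HL _ _ _ _).
    + lra.
    + intros z Hz; apply Hdil; [lia|exact Hz].
    + intros z Hz; apply Hdil; [exact Hk|exact Hz].
    + now rewrite !Cmult_0_r.
    + intros z Hz.
      destruct (Hdil k z ltac:(lia) Hz) as [_ HQ].
      replace (P (t (S k) * z) / P (t k * z) - 1)%C
        with ((P (t (S k) * z) - P (t k * z)) / P (t k * z))%C by (field; exact HQ).
      rewrite Cmod_div by exact HQ.
      assert (Hmk : m <= Cmod (P (t k * z)%C)).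
      { apply Hm; generalize (Hin (t k) z (Ht k ltac:(lia))); lra. }
      assert (Hdiff : Cmod (P (t (S k) * z) - P (t k * z))%C <=
        2 * B * Cmod (t (S k) * z - t k * z)%C).
      { assert (Hseg : forall s, 0 <= s <= 1 ->
          Cmod (t k * z + s * (t (S k) * z - t k * z))%C < r).
        { intros s Hs; replace (t k * z + s * (t (S k) * z - t k * z))%C
            with (RtoC (t k + s * (t (S k) - t k)) * z)%C
            by (rewrite RtoC_plus, RtoC_mult, RtoC_minus; ring).
          eapply Rle_lt_trans; [apply Hin|exact Hz].
          pose proof (Ht k ltac:(lia)); pose proof (Ht (S k) Hk); nra. }
        apply (cder_mean_value P P1).
        - intros s Hs; apply HP; generalize (Hseg s Hs); lra.
        - intros s Hs; apply HB; generalize (Hseg s Hs); lra. }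
      replace (t (S k) * z - t k * z)%C with (RtoC (/ INR N) * z)%C in Hdiff.
      2:{ replace (/ INR N) with (t (S k) - t k)
            by (unfold t; rewrite S_INR; field; lra).
          rewrite RtoC_minus; ring. }
      rewrite Cmod_mult, Cmod_R, Rabs_pos_eq in Hdiff
        by (left; now apply Rinv_0_lt_compat).
      apply (Rmult_lt_reg_r (Cmod (P (t k * z)%C))); [lra|].
      unfold Rdiv; rewrite Rmult_assoc, Rinv_l, Rmult_1_l, Rmult_1_r by lra.
      eapply Rle_lt_trans; [exact Hdiff|].
      apply Rlt_le_trans with (2 := Hmk).
      apply (Rmult_lt_reg_l (INR N)); [exact HN0|].
      replace (INR N * (2 * B * (/ INR N * Cmod z))) with (2 * B * Cmod z)
        by (field; lra).
      pose proof (Cmod_ge_0 z); nra. }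
destruct (Hk N (Nat.le_refl _)) as [L [L0 HL]].
exists L; split; [exact L0|]; intros z Hz; specialize (HL z Hz); cbv beta in HL.
replace (t N) with 1 in HL by (unfold t; field; lra).
now rewrite !Cmult_1_l in HL.
Qed.

(** The value at [z] is read from the logarithm on the disk of radius midway between |z| and [R0].
    Any two of these logarithms have the same derivative and vanish at 0, so they agree on the
    smaller disk. *)
Lemma log_exists (P P1 : C -> C) (R0 : R) : 0 < R0 ->
  (forall z, Cmod z < R0 -> cder P z (P1 z)) ->
  (forall z, Cmod z < R0 -> exists l, cder P1 z l) ->
  (forall z, Cmod z < R0 -> P z <> 0%C) -> P 0%C = 1%C ->
  exists L, is_log P P1 L R0.
Proof.
intros HR HP HP1 Hnz HP0.
set (r := fun z : C => (Cmod z + R0) / 2).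
assert (Hex : forall z, exists L, Cmod z < R0 -> is_log P P1 L (r z)).
{ intros z; destruct (Rlt_dec (Cmod z) R0) as [Hz|Hz].
  - destruct (log_exists_smaller_disk P P1 R0 (r z)) as [L HL]; auto.
    + unfold r; generalize (Cmod_ge_0 z); lra.
    + now exists L.
  - exists P; intros H; contradiction. }
set (F := fun z => proj1_sig (constructive_indefinite_description _ (Hex z))).
assert (HF : forall z, Cmod z < R0 -> is_log P P1 (F z) (r z)).
{ intros z; exact (proj2_sig (constructive_indefinite_description _ (Hex z))). }
clearbody F.
exists (fun z => F z z); split; [apply HF; rewrite Cmod_0; exact HR|].
assert (Hagree : forall y z, Cmod y < R0 -> Cmod z < R0 -> Cmod y < r z ->
  F y y = F z y).
{ intros y z Hy Hz Hyz; destruct (HF y Hy) as [A1 A2], (HF z Hz) as [B1 B2].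
  assert (E : (F y y - F z y = F y 0 - F z 0)%C).
  { apply (cder_zero_const (fun w => F y w - F z w)%C (Rmin (r y) (r z))).
    - intros w Hw; apply (cder_eq _ _ (P1 w / P w - P1 w / P w)%C); [|ring].
      apply cder_minus; [apply A2|apply B2];
        (eapply Rlt_le_trans; [exact Hw|]); [apply Rmin_l|apply Rmin_r].
    - apply Rmin_glb_lt; [unfold r; lra|exact Hyz]. }
  replace (F y y) with (F y y - F z y + F z y)%C by ring.
  rewrite E, A1, B1; ring. }
intros z Hz; destruct (HF z Hz) as [_ H].
assert (Hzr : Cmod z < r z) by (unfold r; lra).
destruct (H z Hzr) as [H1 H2]; split; [|exact H2].
apply (cder_ext (F z) _ _ _ (r z - Cmod z)); [lra| |exact H1].
intros y Hy; symmetry; generalize (Cmod_triangle_rev y z); intros.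
apply Hagree; unfold r in *; lra.
Qed.

(** * Maximum principle and Schwarz's lemma *)


Definition Cnorm2 (z : C) : R := Re z * Re z + Im z * Im z.

Definition Cdot (y z : C) : R := Re y * Re z + Im y * Im z.

Lemma Cnorm2_Cmod (z : C) : Cnorm2 z = Cmod z * Cmod z.
Proof. unfold Cnorm2; generalize (Cmod2_alt z); simpl; intros; lra. Qed.

Lemma is_derive_dot (a b c d : R -> R) (t a' b' c' d' : R) :
  is_derive a t a' -> is_derive b t b' -> is_derive c t c' -> is_derive d t d' ->
  is_derive (fun t => a t * c t + b t * d t) t
    (a' * c t + a t * c' + (b' * d t + b t * d')).
Proof.
rewrite !is_derive_Reals; intros Ha Hb Hc Hd.
exact (derivable_pt_lim_plus _ _ _ _ _ (derivable_pt_lim_mult _ _ _ _ _ Ha Hc)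
  (derivable_pt_lim_mult _ _ _ _ _ Hb Hd)).
Qed.

Lemma is_derive_lin_comb (f g : R -> R) (c t f' g' : R) :
  is_derive f t f' -> is_derive g t g' ->
  is_derive (fun t => f t + c * g t) t (f' + c * g').
Proof.
rewrite !is_derive_Reals; intros Hf Hg.
exact (derivable_pt_lim_plus _ _ _ _ _ Hf (derivable_pt_lim_scal _ c _ _ Hg)).
Qed.

Lemma is_derive_Cnorm2_line (f : C -> C) (w e l : C) (t : R) :
  cder f (w + t * e)%C l ->
  is_derive (fun t : R => Cnorm2 (f (w + t * e)%C)) t
    (2 * Cdot (f (w + t * e)%C) (l * e)%C).
Proof.
intros H; pose proof (cder_line_re _ _ _ _ _ H) as Hr.
pose proof (cder_line_im _ _ _ _ _ H) as Hi.
replace (2 * Cdot (f (w + t * e)%C) (l * e)%C) with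
  (Re (l * e)%C * Re (f (w + t * e)%C) + Re (f (w + t * e)%C) * Re (l * e)%C +
   (Im (l * e)%C * Im (f (w + t * e)%C) + Im (f (w + t * e)%C) * Im (l * e)%C))
  by (unfold Cdot; ring).
exact (is_derive_dot _ _ _ _ _ _ _ _ _ Hr Hi Hr Hi).
Qed.

Lemma is_derive_Cdot_line (f g : C -> C) (w e l m : C) (t : R) :
  cder f (w + t * e)%C l -> cder g (w + t * e)%C m ->
  is_derive (fun t : R => Cdot (f (w + t * e)%C) (g (w + t * e)%C * e)%C) t
    (Cdot (l * e)%C (g (w + t * e) * e)%C + Cdot (f (w + t * e)%C) (m * e * e)%C).
Proof.
intros Hf Hg.
assert (Hge : cder (fun y => g y * e)%C (w + t * e)%C (m * e)%C).
{ eapply cder_eq; [apply cder_mult; [exact Hg|apply cder_const]|cbv beta; ring]. }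
replace (Cdot (l * e)%C (g (w + t * e) * e)%C + Cdot (f (w + t * e)%C) (m * e * e)%C) with
  (Re (l * e)%C * Re (g (w + t * e) * e)%C + Re (f (w + t * e)%C) * Re (m * e * e)%C +
   (Im (l * e)%C * Im (g (w + t * e) * e)%C + Im (f (w + t * e)%C) * Im (m * e * e)%C))
  by (unfold Cdot; ring).
exact (is_derive_dot _ _ _ _ _ _ _ _ _
  (cder_line_re _ _ _ _ _ Hf) (cder_line_im _ _ _ _ _ Hf)
  (cder_line_re _ _ _ _ _ Hge) (cder_line_im _ _ _ _ _ Hge)).
Qed.

(** [f1] is differentiable only at 0: a positive [l] would make [f1] positive just to the right of
    0, and the mean value theorem carries this to [f]. *)
Lemma second_derivative_at_max (f f1 : R -> R) (d l : R) : 0 < d ->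
  (forall t, Rabs t < d -> is_derive f t (f1 t)) -> is_derive f1 0 l ->
  (forall t, Rabs t < d -> f t <= f 0) -> l <= 0.
Proof.
intros Hd Hf Hf1 Hmax; apply Rnot_lt_le; intros Hl.
assert (Hr : forall t, 0 < t < d -> is_derive f t (f1 t)).
{ intros t Ht; apply Hf; rewrite Rabs_pos_eq; lra. }
assert (H0 : derivable_pt_lim f 0 (f1 0))
  by (apply is_derive_Reals, Hf; rewrite Rabs_R0; exact Hd).
assert (E0 : f1 0 = 0).
{ set (pr := exist _ (f1 0) H0 : derivable_pt f 0).
  change (derive_pt f 0 pr = 0); apply (deriv_maximum f (- d) d); try lra.
  intros x Hx1 Hx2; apply Hmax, Rabs_def1; lra. }
apply is_derive_Reals in Hf1.
destruct (derivable_pt_lim_bound_0 f1 l Hf1 (l / 2)) as [d' [Hd' Hb]]; [lra|].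
set (h := Rmin d d' / 2).
assert (Hh : 0 < h) by (unfold h; generalize (Rmin_pos d d' Hd Hd'); lra).
assert (Hhd : h < d) by (unfold h in *; generalize (Rmin_l d d'); lra).
assert (Hhd' : h < d') by (unfold h in *; generalize (Rmin_r d d'); lra).
destruct (MVT_derive f f1 0 h Hh) as [c [Hc E]].
{ intros x Hx; apply Hf; rewrite Rabs_pos_eq; lra. }
specialize (Hb c); rewrite (Rabs_pos_eq c) in Hb by lra.
specialize (Hb ltac:(lra)); apply Rabs_le_between in Hb; rewrite E0 in Hb.
assert (0 < f1 c * (h - 0)) by (apply Rmult_lt_0_compat; nra).
specialize (Hmax h); rewrite (Rabs_pos_eq h) in Hmax by lra.
specialize (Hmax Hhd); lra.
Qed.

Lemma derivative_nonpos_right (f : R -> R) (d l : R) : 0 < d -> is_derive f 0 l ->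
  (forall t, 0 < t < d -> f t <= f 0) -> l <= 0.
Proof.
intros Hd Hf H; apply Rnot_lt_le; intros Hl.
apply is_derive_Reals in Hf.
destruct (derivable_pt_lim_bound_0 f l Hf (l / 2)) as [d' [Hd' Hb]]; [lra|].
set (h := Rmin d d' / 2).
assert (Hh : 0 < h) by (unfold h; generalize (Rmin_pos d d' Hd Hd'); lra).
assert (Hhd : h < d) by (unfold h in *; generalize (Rmin_l d d'); lra).
assert (Hhd' : h < d') by (unfold h in *; generalize (Rmin_r d d'); lra).
specialize (Hb h); rewrite (Rabs_pos_eq h) in Hb by lra.
specialize (Hb Hhd'); apply Rabs_le_between in Hb.
specialize (H h ltac:(lra)); nra.
Qed.

(** The regularity that the Laplacian computation uses. Its closure under products and powers spares
    an explicit second derivative of w (w / z)^k. *)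
Definition twice_cder (f : C -> C) (z : C) : Prop :=
  exists f1, (exists d, 0 < d /\ forall y, Cmod (y - z) < d -> cder f y (f1 y)) /\
    exists l, cder f1 z l.

(* The Laplacian of [|G|^2 + eps |z|^2] is [4 |G'|^2 + 4 eps > 0], whereas both
   second derivatives would be nonpositive at a maximum. *)
Lemma no_interior_max (G : C -> C) (z : C) (eps d : R) : twice_cder G z ->
  0 < eps -> 0 < d ->
  (forall y, Cmod (y - z) < d ->
     Cnorm2 (G y) + eps * Cnorm2 y <= Cnorm2 (G z) + eps * Cnorm2 z) -> False.
Proof.
intros [G1 [[d1 [Hd1 HG]] [G2 HG1]]] Heps Hd Hmax.
assert (Hdir : forall e, Cmod e = 1 ->
  2 * (Cdot (G1 z * e)%C (G1 z * e)%C + Cdot (G z) (G2 * e * e)%C) +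
  eps * (2 * (Cdot (1 * e)%C (1 * e)%C + Cdot z (0 * e * e)%C)) <= 0).
{ intros e He.
  assert (E0 : (z + 0 * e)%C = z) by ring.
  assert (Hline : forall t : R, Cmod (z + t * e - z)%C = Rabs t).
  { intros t; replace (z + t * e - z)%C with (t * e)%C by ring.
    rewrite Cmod_mult, Cmod_R, He; ring. }
  apply (second_derivative_at_max
    (fun t : R => Cnorm2 (G (z + t * e)%C) + eps * Cnorm2 (z + t * e)%C)
    (fun t : R => 2 * Cdot (G (z + t * e)%C) (G1 (z + t * e) * e)%C
       + eps * (2 * Cdot (z + t * e)%C (1 * e)%C)) (Rmin d d1)).
  - now apply Rmin_pos.
  - intros t Ht; apply is_derive_lin_comb.
    + apply is_derive_Cnorm2_line, HG; rewrite Hline.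
      eapply Rlt_le_trans; [exact Ht|apply Rmin_r].
    + apply (is_derive_Cnorm2_line (fun y => y)), cder_id.
  - apply is_derive_lin_comb.
    + apply (is_derive_scal (fun t : R => Cdot (G (z + t * e)%C) (G1 (z + t * e) * e)%C)).
      generalize (is_derive_Cdot_line G G1 z e (G1 z) G2 0); rewrite !E0; intros HD.
      apply HD; [|exact HG1].
      apply HG; replace (z - z)%C with (RtoC 0) by ring; now rewrite Cmod_0.
    + apply (is_derive_scal (fun t : R => Cdot (z + t * e)%C (1 * e)%C)).
      generalize (is_derive_Cdot_line (fun y => y) (fun _ => 1%C) z e 1 0 0);
        rewrite !E0; intros HD.
      apply HD; [apply cder_id|apply cder_const].
  - intros t Ht; rewrite E0; apply Hmax; rewrite Hline.
    eapply Rlt_le_trans; [exact Ht|apply Rmin_l]. }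
(* Adding the inequalities for the directions 1 and i cancels the terms in [G2], because 1^2 + i^2 =
   0. *)
pose proof (Hdir 1%C Cmod_1) as H1; pose proof (Hdir Ci Cmod_Ci) as H2.
unfold Cdot, Ci in H1, H2; destruct (G1 z) as [a b], (G z) as [p q], G2 as [m n].
simpl in H1, H2; nra.
Qed.

Lemma twice_cder_mult (f g : C -> C) (z : C) :
  twice_cder f z -> twice_cder g z -> twice_cder (fun y => f y * g y)%C z.
Proof.
intros [f1 [[d [Hd Hf]] [f2 Hf1]]] [g1 [[d' [Hd' Hg]] [g2 Hg1]]].
assert (Ez : Cmod (z - z) = 0)
  by (replace (z - z)%C with (RtoC 0) by ring; apply Cmod_0).
exists (fun y => f1 y * g y + f y * g1 y)%C; split.
- exists (Rmin d d'); split; [now apply Rmin_pos|]; intros y Hy.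
  apply cder_mult; [apply Hf|apply Hg]; (eapply Rlt_le_trans; [exact Hy|]);
    [apply Rmin_l|apply Rmin_r].
- eexists; apply cder_plus; apply cder_mult;
    first [exact Hf1|exact Hg1|apply Hf; rewrite Ez; exact Hd|apply Hg; rewrite Ez; exact Hd'].
Qed.

Lemma twice_cder_inv_id (z : C) : z <> 0%C -> twice_cder (fun y => / y)%C z.
Proof.
intros Hz; exists (fun y => - / (y * y))%C; split.
- exists (Cmod z); split; [now apply Cmod_gt_0|]; intros y Hy.
  apply cder_inv_id; intros ->.
  replace (0 - z)%C with (- z)%C in Hy by ring; rewrite Cmod_opp in Hy; lra.
- eexists; apply cder_opp, (cder_inv (fun y => y * y)%C); [now apply Cmult_neq_0|].
  apply (cder_mult (fun y => y) (fun y => y)); apply cder_id.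
Qed.

Lemma twice_cder_pow (f : C -> C) (z : C) (n : nat) :
  twice_cder f z -> twice_cder (fun y => f y ^ n)%C z.
Proof.
intros Hf; induction n as [|n IH]; simpl.
- exists (fun _ => 0%C); split; [exists 1; split; [lra|]; intros y _|exists 0%C];
    apply cder_const.
- now apply twice_cder_mult.
Qed.

Lemma circle_attains_max_Cmod (f : C -> C) (r : R) : 0 < r ->
  (forall z, Cmod z = r -> exists l, cder f z l) ->
  exists z, Cmod z = r /\ forall y, Cmod y = r -> Cmod (f y) <= Cmod (f z).
Proof.
intros Hr Hf.
apply (usc_attains_max (fun z => Cmod z = r) (fun z => Cmod (f z)) r (RtoC r)).
- rewrite Cmod_R, Rabs_pos_eq; lra.
- intros z ->; lra.
- intros z Hz; exists (Rabs (Cmod z - r)); split; [apply Rabs_pos_lt; lra|].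
  intros y Hy E; apply (Rlt_not_le _ _ Hy).
  apply Rabs_le_between; generalize (Cmod_triangle_rev y z) (Cmod_triangle_rev z y).
  rewrite (Cmod_minus_sym z y), E; lra.
- intros z eps Hz Heps; destruct (Hf z Hz) as [l Hl].
  destruct (cder_cont f z l eps Hl Heps) as [d [Hd H]].
  exists d; split; [exact Hd|]; intros y _ Hy; specialize (H y Hy).
  generalize (Cmod_triangle_rev (f y) (f z)); lra.
Qed.

Lemma pow_ratio_dominates (A x m y : R) : 0 < A -> 0 <= y < x -> 0 <= m ->
  exists k, m * y ^ k < A * x ^ k.
Proof.
intros HA Hy Hm.
destruct (Req_dec y 0) as [->|Hy0].
- exists 1%nat; simpl; nra.
- assert (Hxy : 1 < x / y).
  { apply (Rmult_lt_reg_r y); [lra|]; unfold Rdiv; rewrite Rmult_assoc, Rinv_l; lra. }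
  destruct (Pow_x_infinity (x / y)) with (b := m / A + 1) as [N HN].
  { rewrite Rabs_pos_eq; lra. }
  specialize (HN N (Nat.le_refl _)); rewrite <- RPow_abs, Rabs_pos_eq in HN by lra.
  exists N.
  assert (Hp : 0 < y ^ N) by (apply pow_lt; lra).
  assert (E : x ^ N = (x / y) ^ N * y ^ N)
    by (rewrite <- Rpow_mult_distr; f_equal; field; exact Hy0).
  rewrite E, <- Rmult_assoc; apply Rmult_lt_compat_r; [exact Hp|].
  assert (Hm' : m < (m / A + 1) * A) by (unfold Rdiv; rewrite Rmult_plus_distr_r, Rmult_assoc, Rinv_l; lra).
  eapply Rlt_le_trans; [exact Hm'|].
  rewrite (Rmult_comm A); apply Rmult_le_compat_r; lra.
Qed.

(* The maximum principle is applied to [w (w / z)^k], which extends by [0] to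
   the origin, so that the removable singularity of [w / z] is not needed; the
   bound for [w / z] results from letting [k] tend to infinity. *)
Lemma schwarz_on_circle (w w1 : C -> C) (R0 r : R) : 0 < r < R0 ->
  (forall z, Cmod z < R0 -> cder w z (w1 z)) ->
  (forall z, Cmod z < R0 -> exists l, cder w1 z l) -> w 0%C = 0%C ->
  exists z0, Cmod z0 = r /\
    forall z, Cmod z <= r -> Cmod (w z) * r <= Cmod z * Cmod (w z0).
Proof.
intros Hr Hw Hw1 Hw0.
destruct (circle_attains_max_Cmod w r) as [z0 [Hz0 Hm]];
  [lra|intros z Hz; exists (w1 z); apply Hw; lra|].
exists z0; split; [exact Hz0|]; set (m := Cmod (w z0)) in *.
assert (Hm0 : 0 <= m) by apply Cmod_ge_0.
intros z1 Hz1; apply Rnot_lt_le; intros Hlt.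
assert (Hz1p : 0 < Cmod z1).
{ apply Cmod_gt_0; intros ->; rewrite Hw0, Cmod_0 in Hlt; lra. }
assert (HA : 0 < Cmod (w z1)) by nra.
set (G := fun k z => (w z * (w z * / z) ^ k)%C).
assert (HG : forall k (z : C), z <> 0%C -> Cmod (G k z) = Cmod (w z) * (Cmod (w z) / Cmod z) ^ k).
{ intros k z Hz; unfold G; rewrite Cmod_mult, Cmod_pow, Cmod_mult, Cmod_inv by exact Hz.
  reflexivity. }
assert (HG0 : forall k, G k 0%C = 0%C) by (intros k; unfold G; rewrite Hw0; ring).
(* The negated claim says |w z1| / |z1| > m / r, so a large power [k] makes |G k z1| exceed the
   bound for [G k] on the circle. *)
destruct (pow_ratio_dominates (Cmod (w z1)) (Cmod (w z1) / Cmod z1) m (m / r) HA)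
  as [k Hk]; [|exact Hm0|].
{ split; [apply Rmult_le_pos; [exact Hm0|left; apply Rinv_0_lt_compat; lra]|].
  apply (Rmult_lt_reg_r (r * Cmod z1)); [nra|].
  replace (m / r * (r * Cmod z1)) with (Cmod z1 * m) by (field; lra).
  replace (Cmod (w z1) / Cmod z1 * (r * Cmod z1)) with (Cmod (w z1) * r) by (field; lra).
  exact Hlt. }
rewrite <- HG in Hk by (now apply Cmod_gt_0).
set (Bd := m * (m / r) ^ k) in *.
assert (HBd : 0 <= Bd).
{ apply Rmult_le_pos; [exact Hm0|]; apply pow_le, Rmult_le_pos;
    [exact Hm0|left; apply Rinv_0_lt_compat; lra]. }
set (N := Cnorm2 (G k z1)).
assert (HN : Bd * Bd < N) by (unfold N; rewrite Cnorm2_Cmod; nra).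
(* On the circle the added term eps |z|^2 equals half of the gap [N - Bd * Bd], so the value at [z1]
   still exceeds every value on the circle. *)
set (eps := (N - Bd * Bd) / (2 * (r * r))).
assert (Heps : 0 < eps) by (unfold eps; apply Rdiv_lt_0_compat; nra).
assert (Heps2 : Bd * Bd + eps * (r * r) < N).
{ unfold eps; replace ((N - Bd * Bd) / (2 * (r * r)) * (r * r)) with ((N - Bd * Bd) / 2)
    by (field; lra); lra. }
set (psi := fun z => Cnorm2 (G k z) + eps * Cnorm2 z).
assert (HGd : forall z : C, Cmod z < R0 -> z <> 0%C -> exists l, cder (G k) z l).
{ intros z Hz Hz0'; destruct (twice_cder_mult w (fun z => (w z * / z) ^ k)%C z)
    as [G1 [[d [Hd H]] _]].
  - exists w1; split; [|apply Hw1, Hz]; exists (R0 - Cmod z); split; [lra|].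
    intros y Hy; apply Hw; generalize (Cmod_triangle_rev y z); lra.
  - apply twice_cder_pow, twice_cder_mult; [|now apply twice_cder_inv_id].
    exists w1; split; [|apply Hw1, Hz]; exists (R0 - Cmod z); split; [lra|].
    intros y Hy; apply Hw; generalize (Cmod_triangle_rev y z); lra.
  - exists (G1 z); apply H; replace (z - z)%C with (RtoC 0) by ring; now rewrite Cmod_0. }
assert (Hcont : forall (z : C) e, Cmod z <= r -> 0 < e -> exists d, 0 < d /\
  forall y, Cmod y <= r -> Cmod (y - z) < d -> Cmod (G k y - G k z) < e).
{ intros z e Hz He; destruct (Ceq_dec z 0) as [->|Hnz].
  (* At the origin the ratio |w / z| is merely bounded, by [B]; the one extra factor [w] supplies
     the smallness. *)
  - destruct (Hw 0%C ltac:(rewrite Cmod_0; lra) 1 Rlt_0_1) as [d [Hd H]].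
    set (B := 1 + Cmod (w1 0%C)).
    assert (HB : 1 <= B) by (unfold B; generalize (Cmod_ge_0 (w1 0%C)); lra).
    assert (HBk : 0 < B * B ^ k) by (apply Rmult_lt_0_compat; [lra|apply pow_lt; lra]).
    exists (Rmin d (e / (B * B ^ k))); split;
      [apply Rmin_pos; [exact Hd|now apply Rdiv_lt_0_compat]|].
    intros y _ Hy.
    assert (Hy1 : Cmod (y - 0) < d) by (eapply Rlt_le_trans; [exact Hy|apply Rmin_l]).
    assert (Hy2 : Cmod (y - 0) < e / (B * B ^ k))
      by (eapply Rlt_le_trans; [exact Hy|apply Rmin_r]).
    specialize (H y Hy1); rewrite Hw0 in H.
    replace (y - 0)%C with y in * by ring.
    rewrite HG0; replace (G k y - 0)%C with (G k y) by ring.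
    destruct (Ceq_dec y 0) as [->|Hy0]; [rewrite HG0, Cmod_0; exact He|].
    assert (Hyp : 0 < Cmod y) by (now apply Cmod_gt_0).
    assert (Hwy : Cmod (w y) <= B * Cmod y).
    { replace (w y) with ((w y - 0 - w1 0 * y) + w1 0 * y)%C by ring.
      eapply Rle_trans; [apply Cmod_triangle|]; rewrite Cmod_mult; unfold B; lra. }
    rewrite HG by exact Hy0.
    apply Rle_lt_trans with (B * Cmod y * B ^ k).
    + apply Rmult_le_compat; [apply Cmod_ge_0| |exact Hwy|].
      * apply pow_le, Rmult_le_pos; [apply Cmod_ge_0|left; now apply Rinv_0_lt_compat].
      * apply pow_incr; split.
        -- apply Rmult_le_pos; [apply Cmod_ge_0|left; now apply Rinv_0_lt_compat].
        -- apply (Rmult_le_reg_r (Cmod y)); [exact Hyp|].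
           unfold Rdiv; rewrite Rmult_assoc, Rinv_l by lra; lra.
    + apply (Rmult_lt_compat_r (B * B ^ k)) in Hy2; [|exact HBk].
      unfold Rdiv in Hy2; rewrite Rmult_assoc, Rinv_l in Hy2 by lra; lra.
  - destruct (HGd z ltac:(lra) Hnz) as [l Hl].
    destruct (cder_cont _ z l e Hl He) as [d [Hd H]].
    exists d; split; [exact Hd|]; intros y _; apply H. }
destruct (disk_attains_max psi r) as [z2 [Hz2 Hmax]]; [lra| |].
{ intros z e Hz He.
  set (Mz := Cmod (G k z)); assert (HMz : 0 <= Mz) by apply Cmod_ge_0.
  destruct (Hcont z (Rmin 1 (e / (2 * (2 * Mz + 1)))) Hz) as [d [Hd H]].
  { apply Rmin_pos; [lra|apply Rdiv_lt_0_compat; lra]. }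
  set (q := e / (2 * (eps * (2 * r + 1)))).
  assert (Hden : 0 < eps * (2 * r + 1)) by (apply Rmult_lt_0_compat; lra).
  exists (Rmin d q); split; [apply Rmin_pos; [exact Hd|apply Rdiv_lt_0_compat; lra]|].
  intros y Hyr Hy.
  assert (Hy1 : Cmod (y - z) < d) by (eapply Rlt_le_trans; [exact Hy|apply Rmin_l]).
  assert (Hy2 : Cmod (y - z) < q) by (eapply Rlt_le_trans; [exact Hy|apply Rmin_r]).
  specialize (H y Hyr Hy1).
  assert (Ha : Cmod (G k y - G k z) < 1) by (eapply Rlt_le_trans; [exact H|apply Rmin_l]).
  assert (Hb : Cmod (G k y - G k z) < e / (2 * (2 * Mz + 1)))
    by (eapply Rlt_le_trans; [exact H|apply Rmin_r]).
  apply (Rmult_lt_compat_r (2 * (2 * Mz + 1))) in Hb; [|lra].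
  unfold Rdiv in Hb; rewrite Rmult_assoc, Rinv_l in Hb by lra.
  apply (Rmult_lt_compat_r (2 * (eps * (2 * r + 1)))) in Hy2; [|lra].
  unfold q, Rdiv in Hy2; rewrite Rmult_assoc, Rinv_l in Hy2 by lra.
  unfold psi; rewrite !Cnorm2_Cmod; fold Mz.
  pose proof (Cmod_triangle_rev (G k y) (G k z)) as T1; fold Mz in T1.
  pose proof (Cmod_triangle_rev y z) as T2.
  pose proof (Cmod_ge_0 (G k y)); pose proof (Cmod_ge_0 y); pose proof (Cmod_ge_0 z).
  set (D := Cmod (G k y - G k z)) in *; set (D' := Cmod (y - z)) in *.
  assert (HD : 0 <= D) by apply Cmod_ge_0; assert (HD' : 0 <= D') by apply Cmod_ge_0.
  assert (Cmod (G k y) * Cmod (G k y) <= Mz * Mz + D * (2 * Mz + 1)) by nra.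
  assert (Cmod y * Cmod y <= Cmod z * Cmod z + D' * (2 * r)) by nra.
  assert (eps * (Cmod y * Cmod y) <= eps * (Cmod z * Cmod z) + D' * (eps * (2 * r + 1)))
    by nra.
  lra. }
assert (Hpsi : N <= psi z2).
{ specialize (Hmax z1 Hz1); unfold psi in Hmax at 1; fold N in Hmax.
  assert (0 <= eps * Cnorm2 z1)
    by (apply Rmult_le_pos; [lra|rewrite Cnorm2_Cmod; nra]); lra. }
assert (Hz2nz : z2 <> 0%C).
{ intros ->; unfold psi in Hpsi; rewrite HG0, !Cnorm2_Cmod, Cmod_0 in Hpsi; nra. }
(* An interior maximum of [psi] away from the origin contradicts [no_interior_max]; one on the
   circle contradicts the choice of [k] and [eps]. *)
destruct (Rle_lt_or_eq_dec _ _ Hz2) as [Hin|Hbd].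
- apply (no_interior_max (G k) z2 eps (r - Cmod z2)).
  + assert (Hzz : twice_cder w z2).
    { exists w1; split; [|apply Hw1; lra]; exists (R0 - Cmod z2); split; [lra|].
      intros y Hy; apply Hw; generalize (Cmod_triangle_rev y z2); lra. }
    apply (twice_cder_mult w (fun z => (w z * / z) ^ k)%C); [exact Hzz|].
    apply twice_cder_pow, twice_cder_mult; [exact Hzz|now apply twice_cder_inv_id].
  + exact Heps.
  + lra.
  + intros y Hy; apply Hmax; generalize (Cmod_triangle_rev y z2); lra.
- assert (HGz : Cmod (G k z2) <= Bd).
  { rewrite HG, Hbd by exact Hz2nz; pose proof (Hm z2 Hbd) as Hmz.
    pose proof (Cmod_ge_0 (w z2)) as Hw2.
    assert (Hir : 0 <= / r) by (left; apply Rinv_0_lt_compat; lra).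
    apply Rmult_le_compat; [exact Hw2|apply pow_le, Rmult_le_pos; assumption|exact Hmz|].
    apply pow_incr; split; [apply Rmult_le_pos; assumption|].
    apply Rmult_le_compat_r; assumption. }
  unfold psi in Hpsi; rewrite !Cnorm2_Cmod, Hbd in Hpsi.
  pose proof (Cmod_ge_0 (G k z2)); nra.
Qed.

(** * Jack's lemma and absence of zeros *)


(* Differentiating the comparison of [|w z|] with [|z|] at [z0] in the inward
   directions [z0 (-1 + i s)], for all real [s]. *)
Lemma jack (w : C -> C) (z0 l : C) (r : R) : 0 < r -> Cmod z0 = r ->
  cder w z0 l ->
  (forall z, Cmod z <= r -> Cmod (w z) * r <= Cmod z * Cmod (w z0)) ->
  Im (Cconj (w z0) * (z0 * l))%C = 0 /\
  Cnorm2 (w z0) <= Re (Cconj (w z0) * (z0 * l))%C.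
Proof.
intros Hr Hz0 Hl Hmax.
assert (Hs : forall s, Cnorm2 (w z0) <=
  Re (Cconj (w z0) * (z0 * l))%C + s * Im (Cconj (w z0) * (z0 * l))%C).
{ intros s; set (e := (z0 * (-1, s))%C).
  assert (E0 : (z0 + 0 * e)%C = z0) by ring.
  assert (Hd : is_derive (fun t : R => Cnorm2 (w (z0 + t * e)%C)
      + (- (Cnorm2 (w z0) / (r * r))) * Cnorm2 (z0 + t * e)%C) 0
    (2 * Cdot (w z0) (l * e)%C + (- (Cnorm2 (w z0) / (r * r))) * (2 * Cdot z0 (1 * e)%C))).
  { apply is_derive_lin_comb.
    - generalize (is_derive_Cnorm2_line w z0 e l 0); rewrite E0; auto.
    - generalize (is_derive_Cnorm2_line (fun y => y) z0 e 1 0); rewrite E0; intros HD.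
      apply HD, cder_id. }
  assert (Hneg : 2 * Cdot (w z0) (l * e)%C
     + (- (Cnorm2 (w z0) / (r * r))) * (2 * Cdot z0 (1 * e)%C) <= 0).
  (* The point z0 + t e has squared modulus r^2 (1 - 2 t + t^2 (1 + s^2)), so it stays in the disk
     exactly up to t = 2 / (1 + s^2). *)
  { apply (derivative_nonpos_right _ (2 / (1 + s * s)) _) with (2 := Hd).
    - apply Rdiv_lt_0_compat; nra.
    - intros t Ht; rewrite E0.
      replace (Cnorm2 (w z0) + - (Cnorm2 (w z0) / (r * r)) * Cnorm2 z0) with 0.
      2:{ rewrite (Cnorm2_Cmod z0), Hz0; field; lra. }
      assert (Ht2 : t * (1 + s * s) < 2).
      { destruct Ht as [_ Ht]; apply (Rmult_lt_compat_r (1 + s * s)) in Ht; [|nra].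
        unfold Rdiv in Ht; rewrite Rmult_assoc, Rinv_l in Ht by nra; lra. }
      assert (Hin : Cnorm2 (z0 + t * e)%C <= r * r).
      { replace (Cnorm2 (z0 + t * e)%C) with
          (Cnorm2 z0 * (1 - t * (2 - t * (1 + s * s)))).
        2:{ unfold e, Cnorm2; destruct z0 as [x y]; simpl; ring. }
        rewrite Cnorm2_Cmod, Hz0; assert (0 <= t * (2 - t * (1 + s * s))) by nra; nra. }
      set (z := (z0 + t * e)%C) in *.
      rewrite Cnorm2_Cmod in Hin.
      pose proof (Cmod_ge_0 z); pose proof (Cmod_ge_0 (w z)); pose proof (Cmod_ge_0 (w z0)).
      specialize (Hmax z ltac:(nra)).
      rewrite !Cnorm2_Cmod.
      assert (Hsq : (Cmod (w z) * r) * (Cmod (w z) * r)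
        <= (Cmod z * Cmod (w z0)) * (Cmod z * Cmod (w z0)))
        by (apply Rmult_le_compat; nra).
      apply (Rmult_le_reg_l (r * r)); [nra|]; rewrite Rmult_0_r.
      replace (r * r * (Cmod (w z) * Cmod (w z) +
          - (Cmod (w z0) * Cmod (w z0) / (r * r)) * (Cmod z * Cmod z)))
        with ((Cmod (w z) * r) * (Cmod (w z) * r)
          - (Cmod z * Cmod (w z0)) * (Cmod z * Cmod (w z0))) by (field; lra).
      lra. }
  replace (Cdot z0 (1 * e)%C) with (- (r * r)) in Hneg.
  2:{ rewrite <- Hz0, <- Cnorm2_Cmod; unfold e, Cdot, Cnorm2; destruct z0; simpl; ring. }
  replace (Cdot (w z0) (l * e)%C) with (- (Re (Cconj (w z0) * (z0 * l))%C
     + s * Im (Cconj (w z0) * (z0 * l))%C)) in Hneg.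
  2:{ unfold e, Cdot, Cconj; destruct z0, l, (w (r0, r1)); simpl; ring. }
  replace (- (Cnorm2 (w z0) / (r * r)) * (2 * - (r * r)))
    with (2 * Cnorm2 (w z0)) in Hneg by (field; lra).
  lra. }
set (A := Re (Cconj (w z0) * (z0 * l))%C) in *;
set (B := Im (Cconj (w z0) * (z0 * l))%C) in *; set (N := Cnorm2 (w z0)) in *.
(* An affine function of [s] that is bounded below on the whole line has slope 0; the chosen [s]
   would give N <= N - 1. *)
assert (HB : B = 0).
{ apply NNPP; intros HB; specialize (Hs ((N - A - 1) / B)).
  replace ((N - A - 1) / B * B) with (N - A - 1) in Hs by (field; exact HB); lra. }
split; [exact HB|]; specialize (Hs 0); lra.
Qed.

(** The hypotheses say p = k v with a real k >= 1, and v / (1 + v) has real part at least 1/2 when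
    |v| >= 1. To avoid introducing k, the inequality is multiplied by N = |v|^2; with A = k N it
    becomes a bound for A (x + N), which follows from A >= N, x + N >= 0 and N >= 1. *)
Lemma jack_half_plane (v p : C) : (1 + v)%C <> 0%C -> 1 <= Cmod v ->
  Im (Cconj v * p)%C = 0 -> Cnorm2 v <= Re (Cconj v * p)%C ->
  / 2 <= Re (p / (1 + v))%C.
Proof.
intros Hv Hv1 HIm HRe.
assert (HN : 1 <= Cnorm2 v) by (rewrite Cnorm2_Cmod; nra).
assert (HD : 0 < Cnorm2 (1 + v)%C).
{ rewrite Cnorm2_Cmod; apply Cmod_gt_0 in Hv; nra. }
destruct v as [x y], p as [p q]; unfold Cnorm2 in *; simpl in *.
set (D := (1 + x) * (1 + x) + (0 + y) * (0 + y)) in *.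
replace (p * ((1 + x) / ((1 + x) * ((1 + x) * 1) + (0 + y) * ((0 + y) * 1))) -
  q * (- (0 + y) / ((1 + x) * ((1 + x) * 1) + (0 + y) * ((0 + y) * 1))))
  with ((p * (1 + x) + q * y) / D).
2:{ unfold D; field; unfold D in HD; lra. }
apply (Rmult_le_reg_r D); [exact HD|].
unfold Rdiv; rewrite Rmult_assoc, Rinv_l, Rmult_1_r by lra.
set (N := x * x + y * y) in *; set (A := x * p - - y * q) in *.
assert (EA : p * N = x * A).
{ unfold N, A; replace (p * (x * x + y * y))
    with (x * (x * p - - y * q) - y * (x * q + - y * p)) by ring; rewrite HIm; ring. }
assert (Hx : - N <= x) by (unfold N in *; nra).
assert (Hkey : 0 <= (A - N) * (x + N)) by (apply Rmult_le_pos; lra).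
apply (Rmult_le_reg_l N); [lra|].
replace (N * (p * (1 + x) + q * y)) with (p * N + N * A) by (unfold A; ring).
rewrite EA.
replace (/ 2 * D) with (/ 2 * (1 + 2 * x + N)) by (unfold D, N; ring).
nra.
Qed.

(** Used twice: with [R0] the modulus of a nearest zero, to show that there is none, and then with
    [R0 = 1] for the subordination. *)
Lemma log_schwarz (P P1 L : C -> C) (R0 g : R) : 0 < g -> 0 < R0 ->
  is_log P P1 L R0 ->
  (forall z, Cmod z < R0 -> cder P z (P1 z)) ->
  (forall z, Cmod z < R0 -> exists l, cder P1 z l) ->
  (forall z, Cmod z < R0 -> P z <> 0%C) ->
  (forall z, Cmod z < R0 -> Re (z * P1 z / P z)%C < / (2 * g)) ->
  forall z, Cmod z < R0 -> Cmod (Cexp (g * L z) - 1)%C * R0 <= Cmod z.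
Proof.
intros Hg HR [L0 HL] HP HP1 Hnz Hre z Hz.
set (w := fun z => (Cexp (g * L z) - 1)%C).
set (w1 := fun z => (RtoC g * (P1 z / P z) * Cexp (g * L z))%C).
assert (Hw : forall z, Cmod z < R0 -> cder w z (w1 z)).
{ intros y Hy; apply (cder_eq _ _ (w1 y - 0)%C); [|ring].
  apply cder_minus; [|apply cder_const].
  apply (cder_Cexp (fun z => g * L z)%C), cder_scal, HL, Hy. }
assert (Hw1 : forall z, Cmod z < R0 -> exists l, cder w1 z l).
{ intros y Hy; destruct (HP1 y Hy) as [l Hl]; eexists.
  apply cder_mult; [apply cder_scal, cder_mult; [exact Hl|apply cder_inv;
    [apply Hnz, Hy|apply HP, Hy]]|].
  apply (cder_Cexp (fun z => g * L z)%C), cder_scal, HL, Hy. }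
assert (Hw0 : w 0%C = 0%C).
{ unfold w; rewrite L0, Cmult_0_r, Cexp_0; ring. }
assert (Hr : forall r, Cmod z <= r -> 0 < r < R0 -> Cmod (w z) * r <= Cmod z).
{ intros r Hzr Hr; destruct (schwarz_on_circle w w1 R0 r Hr Hw Hw1 Hw0) as [z0 [Hz0 Hm]].
  destruct (jack w z0 (w1 z0) r ltac:(lra) Hz0 (Hw z0 ltac:(lra)) Hm) as [HI HRe].
  eapply Rle_trans; [apply (Hm z Hzr)|].
  rewrite <- (Rmult_1_r (Cmod z)) at 2.
  apply Rmult_le_compat_l; [apply Cmod_ge_0|].
  apply Rnot_lt_le; intros Hgt.
  assert (E1 : (1 + w z0 = Cexp (g * L z0))%C) by (unfold w; ring).
  assert (H1 : (1 + w z0)%C <> 0%C) by (rewrite E1; apply Cexp_neq_0).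
  pose proof (jack_half_plane (w z0) (z0 * w1 z0)%C H1 ltac:(lra) HI HRe) as Hhalf.
  replace (z0 * w1 z0 / (1 + w z0))%C with (RtoC g * (z0 * P1 z0 / P z0))%C in Hhalf.
  2:{ rewrite E1; unfold w1; field; split; [apply Hnz; lra|apply Cexp_neq_0]. }
  specialize (Hre z0 ltac:(lra)).
  replace (Re (g * (z0 * P1 z0 / P z0))%C) with (g * Re (z0 * P1 z0 / P z0)%C) in Hhalf.
  2:{ generalize (z0 * P1 z0 / P z0)%C; intros [a b]; simpl; ring. }
  apply (Rmult_lt_compat_l g) in Hre; [|exact Hg].
  replace (g * / (2 * g)) with (/ 2) in Hre by (field; lra); lra. }
(* Passage from all r < R0 to [R0] itself: if the bound failed at [R0], it would already fail at a
   radius between |z| / |w z| and [R0]. *)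
fold (w z); apply Rnot_lt_le; intros Hgt.
pose proof (Cmod_ge_0 z) as Hz0; pose proof (Cmod_ge_0 (w z)) as Hwz.
assert (Hwp : 0 < Cmod (w z)) by nra.
set (r0 := Rmax (Cmod z) (Cmod z / Cmod (w z))).
assert (Hr0 : r0 < R0).
{ apply Rmax_lub_lt; [exact Hz|].
  apply (Rmult_lt_reg_r (Cmod (w z))); [exact Hwp|].
  unfold Rdiv; rewrite Rmult_assoc, Rinv_l; lra. }
assert (Hr1 : Cmod z <= r0) by apply Rmax_l.
assert (Hr2 : Cmod z / Cmod (w z) <= r0) by apply Rmax_r.
specialize (Hr ((r0 + R0) / 2) ltac:(lra) ltac:(lra)).
assert (Cmod z < Cmod (w z) * ((r0 + R0) / 2)); [|lra].
apply (Rmult_le_compat_l (Cmod (w z))) in Hr2; [|lra].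
replace (Cmod (w z) * (Cmod z / Cmod (w z))) with (Cmod z) in Hr2 by (field; lra).
nra.
Qed.

Lemma le_of_derive_nonpos (f f1 : R -> R) (a b : R) : a <= b ->
  (forall t, a <= t <= b -> is_derive f t (f1 t)) ->
  (forall t, a <= t <= b -> f1 t <= 0) -> f b <= f a.
Proof.
intros Hab Hf Hf1; destruct (Req_dec a b) as [->|Hne]; [lra|].
destruct (MVT_derive f f1 a b) as [c [Hc E]]; [lra|exact Hf|].
specialize (Hf1 c ltac:(lra)); nra.
Qed.

(** Gronwall's argument for h(s) = |P(s z0)|^2. Where [P] is nonzero, s h' = 2 h Re (z P' / P) <= 2
    M h, and s >= 1 with M >= 0 gives h' <= 2 M h; at a zero both sides vanish. Hence h(s) exp(-2 M
    s) does not increase, and it starts from 0. *)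
Lemma zero_propagates_outward (P P1 : C -> C) (R0 M t : R) (z0 : C) : 0 <= M ->
  (forall z, Cmod z < R0 -> cder P z (P1 z)) ->
  (forall z, Cmod z < R0 -> P z <> 0%C -> Re (z * P1 z / P z)%C <= M) ->
  P z0 = 0%C -> 1 <= t -> t * Cmod z0 < R0 -> P (t * z0)%C = 0%C.
Proof.
intros HM HP Hre H0 Ht HtR.
assert (Hin : forall s, 0 <= s <= t -> Cmod (0 + s * z0)%C < R0).
{ intros s Hs; rewrite Cplus_0_l, Cmod_mult, Cmod_R, Rabs_pos_eq by lra.
  generalize (Cmod_ge_0 z0); nra. }
set (h := fun s : R => Cnorm2 (P (0 + s * z0)%C)).
set (h1 := fun s : R => 2 * Cdot (P (0 + s * z0)%C) (P1 (0 + s * z0) * z0)%C).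
assert (Hh : forall s, 0 <= s <= t -> is_derive h s (h1 s)).
{ intros s Hs; apply is_derive_Cnorm2_line, HP, Hin, Hs. }
assert (Hh1 : forall s, 1 <= s <= t -> h1 s <= 2 * M * h s).
{ intros s Hs; specialize (Hre _ (Hin s ltac:(lra))); unfold h1, h.
  set (z := (0 + s * z0)%C) in *.
  destruct (Ceq_dec (P z) 0) as [E|Hnz].
  - rewrite E; unfold Cdot, Cnorm2; simpl; lra.
  - specialize (Hre Hnz).
    assert (Hn : 0 < Cnorm2 (P z)).
    { rewrite Cnorm2_Cmod; apply Cmod_gt_0 in Hnz; nra. }
    assert (E : s * Cdot (P z) (P1 z * z0)%C = Cnorm2 (P z) * Re (z * P1 z / P z)%C).
    { replace (z * P1 z / P z)%C with (RtoC s * (P1 z * z0) / P z)%C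
        by (unfold z; field; exact Hnz).
      generalize (P1 z * z0)%C; intros [a b].
      unfold Cnorm2 in *; destruct (P z) as [x y]; unfold Cdot; simpl in *.
      field; lra. }
    assert (Hle : s * Cdot (P z) (P1 z * z0)%C <= Cnorm2 (P z) * M)
      by (rewrite E; apply Rmult_le_compat_l; lra).
    destruct (Rle_dec (Cdot (P z) (P1 z * z0)%C) 0) as [Hc|Hc]; nra. }
assert (Hk : h t * exp (- (2 * M) * t) <= h 1 * exp (- (2 * M) * 1)).
{ apply (le_of_derive_nonpos (fun s => h s * exp (- (2 * M) * s))
    (fun s => h1 s * exp (- (2 * M) * s) + h s * (exp (- (2 * M) * s) * (- (2 * M)))));
    [exact Ht| |].
  - intros s Hs; apply is_derive_Reals.
    refine (derivable_pt_lim_mult h (fun s => exp (- (2 * M) * s)) s _ _ _ _);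
      [apply is_derive_Reals, Hh; lra|].
    refine (derivable_pt_lim_comp (fun s => - (2 * M) * s) exp s (- (2 * M)) _ _
      (derivable_pt_lim_exp _)).
    apply is_derive_Reals; auto_derive; [exact I|ring].
  - intros s Hs; specialize (Hh1 s Hs); pose proof (exp_pos (- (2 * M) * s)).
    replace (h1 s * exp (- (2 * M) * s) + h s * (exp (- (2 * M) * s) * - (2 * M)))
      with ((h1 s - 2 * M * h s) * exp (- (2 * M) * s)) by ring.
    nra. }
replace (h 1) with 0 in Hk.
2:{ unfold h; rewrite Cplus_0_l, Cmult_1_l, H0; unfold Cnorm2; simpl; ring. }
rewrite Rmult_0_l in Hk.
assert (Hht : h t = 0).
{ assert (0 <= h t) by (unfold h; rewrite Cnorm2_Cmod; generalize (Cmod_ge_0 (P (0 + t * z0)%C)); nra).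
  pose proof (exp_pos (- (2 * M) * t)); nra. }
unfold h in Hht; rewrite Cplus_0_l, Cnorm2_Cmod in Hht.
apply Cmod_eq_0; nra.
Qed.

(** Induction on [N] for all series at once: the derived series vanishes on the same part of the
    ray, and the mean value bound between t z0 and the zero z0 turns its order N into order N + 1
    for [u]. *)
Lemma flat_along_ray (z0 : C) (T : R) (N : nat) : 1 < T -> T * Cmod z0 <= 1 ->
  forall u, subexp u ->
  (forall t : R, 1 <= t < T -> CPSeries u (t * z0)%C = 0%C) ->
  exists K, forall t, 0 <= t <= 1 -> Cmod (CPSeries u (t * z0)%C) <= K * (1 - t) ^ N.
Proof.
intros HT Hz0; pose proof (Cmod_ge_0 z0) as Hz0p.
assert (Hz1 : Cmod z0 < 1) by nra.
assert (Hin : forall t, 0 <= t < T -> Cmod (t * z0)%C < 1).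
{ intros t Ht; rewrite Cmod_mult, Cmod_R, Rabs_pos_eq by lra.
  destruct Hz0p as [Hp|Hp]; [nra|rewrite <- Hp; lra]. }
induction N as [|N IH]; intros u Hu Hray.
- destruct (CPSeries_bounded u (Cmod z0) Hu ltac:(lra)) as [B HB].
  exists B; intros t Ht; simpl; rewrite Rmult_1_r; apply HB.
  rewrite Cmod_mult, Cmod_R, Rabs_pos_eq by lra; nra.
- assert (Hd : forall t : R, 0 <= t < T ->
    cder (CPSeries u) (0 + t * z0)%C (CPSeries (dcoef u) (0 + t * z0)%C)).
  { intros t Ht; apply CPSeries_cder; [exact Hu|].
    rewrite Cplus_0_l; apply Hin, Ht. }
  destruct (Ceq_dec z0 0) as [->|Hnz0].
  { exists 0; intros t Ht; specialize (Hray 1 ltac:(lra)).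
    rewrite Cmult_0_r in Hray |- *; rewrite Hray, Cmod_0; lra. }
  destruct (IH (dcoef u) (subexp_dcoef u Hu)) as [K HK].
  { intros t Ht.
    (* At t = 1 vanishing is known only to the right, but an existing derivative is determined by
       its right difference quotients. *)
    assert (Hderiv0 : forall f l, is_derive f t l ->
      (forall s, t <= s < T -> f s = 0) -> l = 0).
    { intros f l Hf H0; apply is_derive_Reals in Hf; apply NNPP; intros Hl.
      destruct (Hf (Rabs l)) as [d Hdd]; [now apply Rabs_pos_lt|].
      set (e := Rmin d (T - t) / 2).
      assert (He : 0 < Rmin d (T - t)) by (apply Rmin_pos; [apply cond_pos|lra]).
      assert (He1 : Rmin d (T - t) <= d) by apply Rmin_l.
      assert (He2 : Rmin d (T - t) <= T - t) by apply Rmin_r.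
      assert (0 < e) by (unfold e; lra).
      specialize (Hdd e ltac:(lra)).
      rewrite (Rabs_pos_eq e) in Hdd by lra.
      specialize (Hdd ltac:(unfold e; lra)).
      rewrite (H0 t), (H0 (t + e)) in Hdd by (unfold e; lra).
      replace ((0 - 0) / e - l) with (- l) in Hdd by (field; lra).
      rewrite Rabs_Ropp in Hdd; lra. }
    specialize (Hd t ltac:(lra)).
    assert (E : (CPSeries (dcoef u) (0 + t * z0) * z0 = 0)%C).
    { apply injective_projections.
      - apply (Hderiv0 _ _ (cder_line_re _ _ _ _ _ Hd)).
        intros s Hs; rewrite Cplus_0_l, Hray by lra; reflexivity.
      - apply (Hderiv0 _ _ (cder_line_im _ _ _ _ _ Hd)).
        intros s Hs; rewrite Cplus_0_l, Hray by lra; reflexivity. }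
    rewrite Cplus_0_l in E.
    replace (CPSeries (dcoef u) (t * z0)%C)
      with (CPSeries (dcoef u) (t * z0) * z0 / z0)%C by (field; exact Hnz0).
    rewrite E; field; exact Hnz0. }
  exists (2 * K); intros t Ht.
  pose proof (cder_mean_value (CPSeries u) (CPSeries (dcoef u)) (1 * z0)%C (t * z0)%C
    (K * (1 - t) ^ N)) as Hmv.
  assert (Hseg : forall s : R, (t * z0 + s * (1 * z0 - t * z0))%C
    = (RtoC (t + s * (1 - t)) * z0)%C)
    by (intros s; rewrite RtoC_plus, RtoC_mult, RtoC_minus; ring).
  assert (HK0 : forall s, 0 <= s <= 1 -> 0 <= K * (1 - s) ^ N).
  { intros s Hs; eapply Rle_trans; [apply Cmod_ge_0|apply (HK s Hs)]. }
  assert (HKp : 0 <= K) by (specialize (HK0 0 ltac:(lra)); rewrite Rminus_0_r, pow1 in HK0; lra).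
  rewrite Hray in Hmv by lra.
  replace (0 - CPSeries u (t * z0))%C with (- CPSeries u (t * z0))%C in Hmv by ring.
  rewrite Cmod_opp in Hmv.
  replace (1 * z0 - t * z0)%C with (RtoC (1 - t) * z0)%C in Hmv
    by (rewrite RtoC_minus; ring).
  rewrite Cmod_mult, Cmod_R, (Rabs_pos_eq (1 - t)) in Hmv by lra.
  eapply Rle_trans; [apply Hmv|].
  + intros s Hs; replace (t * z0 + s * (RtoC (1 - t) * z0))%C
      with (0 + RtoC (t + s * (1 - t)) * z0)%C
      by (rewrite RtoC_plus, RtoC_mult; ring).
    apply Hd; nra.
  + intros s Hs; replace (t * z0 + s * (RtoC (1 - t) * z0))%C
      with (RtoC (t + s * (1 - t)) * z0)%C by (rewrite RtoC_plus, RtoC_mult; ring).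
    eapply Rle_trans; [apply HK; nra|].
    apply Rmult_le_compat_l; [exact HKp|]; apply pow_incr; nra.
  + assert (Hpos : 0 <= K * (1 - t) ^ N) by (apply HK0, Ht); simpl.
    replace (2 * K * ((1 - t) * (1 - t) ^ N))
      with (2 * (K * (1 - t) ^ N) * (1 - t)) by ring.
    apply Rmult_le_compat_l; [lra|]; nra.
Qed.

Lemma no_flat_power (p K : R) (N : nat) : p < INR N ->
  ~ (forall t, 0 <= t < 1 -> exp (p * ln (1 - t)) <= K * (1 - t) ^ N).
Proof.
intros HN H.
assert (HK : 0 < K).
{ specialize (H 0 ltac:(lra)); rewrite Rminus_0_r, pow1 in H.
  generalize (exp_pos (p * ln 1)); lra. }
(* At 1 - t = exp(-X) the inequality becomes linear, X (N - p) <= ln K, and this [X] violates it. *)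
set (X := Rabs (ln K) / (INR N - p) + 1).
assert (HX : 0 < X).
{ unfold X; assert (0 <= Rabs (ln K) / (INR N - p))
    by (apply Rmult_le_pos; [apply Rabs_pos|left; apply Rinv_0_lt_compat; lra]); lra. }
assert (He : 0 < exp (- X) < 1).
{ split; [apply exp_pos|]; rewrite <- exp_0; apply exp_increasing; lra. }
specialize (H (1 - exp (- X)) ltac:(lra)).
replace (1 - (1 - exp (- X))) with (exp (- X)) in H by ring.
rewrite ln_exp, <- Rpower_pow in H by apply exp_pos.
unfold Rpower in H; rewrite ln_exp, <- (exp_ln K HK) in H.
rewrite <- exp_plus in H.
assert (H' : p * - X <= ln K + INR N * - X).
{ apply Rnot_lt_le; intros Hc; apply exp_increasing in Hc; lra. }
assert (HXe : X * (INR N - p) = Rabs (ln K) + (INR N - p)) by (unfold X; field; lra).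
generalize (Rle_abs (ln K)); lra.
Qed.

Lemma series_zero_free (u : nat -> C) (g : R) : 0 < g -> subexp u -> u 0%nat = 1%C ->
  (forall z, Cmod z < 1 -> CPSeries u z <> 0%C ->
     Re (z * CPSeries (dcoef u) z / CPSeries u z)%C < / (2 * g)) ->
  forall z, Cmod z < 1 -> CPSeries u z <> 0%C.
Proof.
intros Hg Hu Hu0 Hre zs Hzs Hzero.
assert (HP0 : CPSeries u 0 = 1%C) by (rewrite CPSeries_0; assumption).
assert (Hd : forall z, Cmod z < 1 -> cder (CPSeries u) z (CPSeries (dcoef u) z))
  by (intros z Hz; now apply CPSeries_cder).
assert (Hdd : forall z, Cmod z < 1 -> exists l, cder (CPSeries (dcoef u)) z l).
{ intros z Hz; eexists; apply CPSeries_cder; [now apply subexp_dcoef|exact Hz]. }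
(* A zero of least modulus: the zeros in the disk of radius |zs| form a compact set, closed by
   continuity of the series. *)
destruct (usc_attains_max (fun z => Cmod z <= Cmod zs /\ CPSeries u z = 0%C)
  (fun z => - Cmod z) (Cmod zs) zs) as [z0 [[Hz0 Hz0z] Hmin]].
- split; [lra|exact Hzero].
- tauto.
- intros z Hz; destruct (Rle_dec (Cmod z) (Cmod zs)) as [Hle|Hgt].
  + assert (Hnz : CPSeries u z <> 0%C) by tauto.
    destruct (cder_cont _ _ _ _ (Hd z ltac:(lra)) (proj1 (Cmod_gt_0 _) Hnz)) as [d [Hdp H]].
    exists d; split; [exact Hdp|]; intros y Hy [_ E]; specialize (H y Hy); rewrite E in H.
    replace (0 - CPSeries u z)%C with (- CPSeries u z)%C in H by ring.
    rewrite Cmod_opp in H; lra.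
  + exists (Cmod z - Cmod zs); split; [lra|]; intros y Hy [Hy' _].
    generalize (Cmod_triangle_rev z y); rewrite (Cmod_minus_sym z y); lra.
- intros z eps _ Heps; exists eps; split; [exact Heps|]; intros y _ Hy.
  generalize (Cmod_triangle_rev z y); rewrite (Cmod_minus_sym z y); lra.
- set (R0 := Cmod z0) in *.
  assert (HR0 : 0 < R0).
  { apply Cmod_gt_0; intros E; rewrite E, HP0 in Hz0z; apply RtoC_inj in Hz0z; lra. }
  assert (Hnz : forall z, Cmod z < R0 -> CPSeries u z <> 0%C).
  { intros z Hz E; specialize (Hmin z ltac:(split; [lra|exact E])); lra. }
  destruct (log_exists (CPSeries u) (CPSeries (dcoef u)) R0) as [L HL]; auto.
  { intros z Hz; apply Hd; lra. }
  { intros z Hz; apply Hdd; lra. }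
  pose proof (log_schwarz _ _ L R0 g Hg HR0 HL ltac:(intros z Hz; apply Hd; lra)
    ltac:(intros z Hz; apply Hdd; lra) Hnz
    ltac:(intros z Hz; apply Hre; [lra|now apply Hnz])) as HS.
  assert (Hinv : 1 < / R0) by (rewrite <- Rinv_1; apply Rinv_lt_contravar; lra).
  (* An order of flatness above 1 / g suffices to contradict the lower bound (1 - t)^(1/g). *)
  destruct (archimed_nat (/ g + 1)) as [N HN]; specialize (HN N (Nat.le_refl _)).
  destruct (flat_along_ray z0 (/ R0) N Hinv) with (u := u) as [K HK].
  { fold R0; rewrite Rinv_l; lra. }
  { exact Hu. }
  { intros t Ht; apply (zero_propagates_outward _ (CPSeries (dcoef u)) 1 (/ (2 * g)) t z0);
      [left; apply Rinv_0_lt_compat; lra|exact Hd| |exact Hz0z|lra|].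
    - intros z Hz Hz'; left; now apply Hre.
    - fold R0; destruct Ht as [_ Ht]; apply (Rmult_lt_compat_r R0) in Ht; [|lra].
      rewrite Rinv_l in Ht; lra. }
  apply (no_flat_power (/ g) K N); [lra|]; intros t Ht.
  eapply Rle_trans; [|apply HK; lra].
  assert (Htz : Cmod (t * z0)%C = t * R0)
    by (rewrite Cmod_mult, Cmod_R, Rabs_pos_eq by lra; reflexivity).
  assert (Htz1 : Cmod (t * z0)%C < R0) by (rewrite Htz; nra).
  destruct HL as [_ HL]; destruct (HL _ Htz1) as [_ EL]; rewrite <- EL.
  rewrite Cmod_Cexp; specialize (HS _ Htz1); rewrite Htz in HS.
  apply Rmult_le_reg_r in HS; [|exact HR0].
  set (l := L (t * z0)%C) in *.
  (* From |exp(g l) - 1| <= t follows exp(g Re l) >= 1 - t, hence |P(t z0)| = exp(Re l) >= (1 -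
     t)^(1/g). *)
  pose proof (Cmod_triangle_rev 1 (- (Cexp (g * l) - 1))) as Htri.
  replace (1 - - (Cexp (g * l) - 1))%C with (Cexp (g * l)) in Htri by ring.
  rewrite Cmod_opp, Cmod_1, Cmod_Cexp in Htri.
  replace (Re (g * l)%C) with (g * Re l) in Htri by (destruct l; simpl; ring).
  assert (Hln : ln (1 - t) <= g * Re l).
  { rewrite <- (ln_exp (g * Re l)); apply ln_le; lra. }
  assert (Hfin : / g * ln (1 - t) <= Re l).
  { apply (Rmult_le_reg_l g); [exact Hg|].
    replace (g * (/ g * ln (1 - t))) with (ln (1 - t)) by (field; lra); exact Hln. }
  destruct Hfin as [Hlt|Heq]; [left; now apply exp_increasing|right; now rewrite Heq].
Qed.

(** * The Hohlov operator *)


Lemma C_pow_n (z : C) (n : nat) : pow_n (K := C_AbsRing) z n = (z ^ n)%C.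
Proof. induction n as [|n IH]; [reflexivity|]; simpl; rewrite IH; reflexivity. Qed.

(** The series converges at the point 1 / q of the disk, so its terms there are bounded. *)
Lemma subexp_Acoef (f : classA) : subexp (Acoef f).
Proof.
intros q Hq; set (z := RtoC (/ q)).
assert (Hq' : 0 < / q < 1).
{ split; [apply Rinv_0_lt_compat; lra|]; rewrite <- Rinv_1; apply Rinv_lt_contravar; lra. }
assert (Hz : Cmod z = / q) by (unfold z; rewrite Cmod_R, Rabs_pos_eq; lra).
assert (Hs : is_series (K := C_AbsRing) (V := C_NormedModule)
  (fun n => scal (pow_n (K := C_AbsRing) z n) (Acoef f n)) (Afun f z)).
{ apply (Afun_series f z); unfold in_disk; lra. }
set (t := fun n => scal (V := C_NormedModule) (pow_n (K := C_AbsRing) z n) (Acoef f n)) in Hs.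
destruct (proj1 (filterlim_locally_ball_norm (K := C_AbsRing)
  (U := C_NormedModule) _ _) Hs (mkposreal 1 Rlt_0_1)) as [N HN].
assert (HN' : forall n, (N <= n)%nat -> Cmod (sum_n t n - Afun f z)%C < 1) by exact HN.
destruct (bounded_prefix (fun n => Cmod (t n)) N) as [B [HB HBn]].
exists (B + 2); intros n.
assert (Hb : Cmod (t n) <= B + 2).
{ destruct (Nat.le_gt_cases n N) as [Hn|Hn]; [specialize (HBn n Hn); simpl in HBn; lra|].
  destruct n as [|n]; [lia|].
  replace (t (S n)) with ((sum_n t (S n) - Afun f z) + - (sum_n t n - Afun f z))%C.
  - eapply Rle_trans; [apply Cmod_triangle|]; rewrite Cmod_opp.
    pose proof (HN' (S n) ltac:(lia)); pose proof (HN' n ltac:(lia)); lra.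
  - rewrite sum_Sn; change (sum_n t n + t (S n) - Afun f z + - (sum_n t n - Afun f z)
      = t (S n))%C; ring. }
replace (t n) with (z ^ n * Acoef f n)%C in Hb
  by exact (eq_sym (f_equal (fun x => Cmult x (Acoef f n)) (C_pow_n z n))).
rewrite Cmod_mult, Cmod_pow, Hz, pow_inv in Hb.
assert (Hqn : 0 < q ^ n) by (apply pow_lt; lra).
apply (Rmult_le_compat_r (q ^ n)) in Hb; [|lra].
replace (/ q ^ n * Cmod (Acoef f n) * q ^ n) with (Cmod (Acoef f n)) in Hb by (field; lra).
exact Hb.
Qed.

Lemma CPSeries_is_pseries (u : nat -> C) (z : C) : subexp u -> Cmod z < 1 ->
  is_pseries (K := C_AbsRing) (V := C_NormedModule) u z (CPSeries u z).
Proof.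
intros Hu Hz; destruct (CPSeries_correct u z Hu Hz) as [H1 H2].
apply (is_series_ext (fun n => (u n * z ^ n)%C)).
{ intros n; rewrite Cmult_comm.
  exact (eq_sym (f_equal (fun x => Cmult x (u n)) (C_pow_n z n))). }
assert (Hre : forall n, fst (sum_n (G := C_NormedModule) (fun n => (u n * z ^ n)%C) n)
              = sum_n (fun n => Re (u n * z ^ n)%C) n).
{ induction n as [|n IH]; [now rewrite !sum_O|].
  rewrite !sum_Sn, <- IH; reflexivity. }
assert (Him : forall n, snd (sum_n (G := C_NormedModule) (fun n => (u n * z ^ n)%C) n)
              = sum_n (fun n => Im (u n * z ^ n)%C) n).
{ induction n as [|n IH]; [now rewrite !sum_O|].
  rewrite !sum_Sn, <- IH; reflexivity. }
apply (proj2 (filterlim_locally _ _)); intros eps.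
destruct (proj1 (filterlim_locally _ _) H1 eps) as [N1 HN1].
destruct (proj1 (filterlim_locally _ _) H2 eps) as [N2 HN2].
exists (max N1 N2); intros n Hn; split.
- rewrite Hre; apply HN1; lia.
- rewrite Him; apply HN2; lia.
Qed.

Definition classA_of_coef (A : nat -> C) (HA : subexp A) (H0 : A 0%nat = 0%C)
  (H1 : A 1%nat = 1%C) : classA :=
  MkClassA (CPSeries A) A
    (fun z Hz => cder_ex_derive _ _ _ (CPSeries_cder A z HA Hz)) H0 H1
    (fun z Hz => CPSeries_is_pseries A z HA Hz).

Lemma subexp_hyp2F1 (a b c : R) : 0 < c -> subexp (hyp2F1_coef a b c).
Proof.
intros Hc.
apply (subexp_ext (fun n => RtoC (poch a n / poch c n) * RtoC (poch b n / poch 1 n))%C).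
- intros n; unfold hyp2F1_coef; rewrite <- RtoC_mult, <- poch_1_fact; f_equal.
  field; generalize (poch_pos c n Hc) (poch_pos 1 n Rlt_0_1); lra.
- apply subexp_mult; apply subexp_poch; lra.
Qed.

(** Coefficients of the function [P] of the overview, the operator divided by z; hence the shift in
    [Acoef]. *)
Definition hcoef (a b c : R) (f : classA) (n : nat) : C :=
  (hyp2F1_coef a b c n * Acoef f (S n))%C.

Lemma subexp_hcoef (a b c : R) (f : classA) : 0 < c -> subexp (hcoef a b c f).
Proof.
intros Hc; apply subexp_mult; [now apply subexp_hyp2F1|].
apply subexp_shift, subexp_Acoef.
Qed.

Lemma hcoef_0 (a b c : R) (f : classA) : hcoef a b c f 0%nat = 1%C.
Proof.
unfold hcoef, hyp2F1_coef; rewrite Acoef_1; simpl.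
replace (1 * 1 / (1 * 1)) with 1 by field; ring.
Qed.

Lemma hohlov_eq (a b c : R) (f : classA) (z : C) : 0 < c -> Cmod z < 1 ->
  hohlov a b c f z = (z * CPSeries (hcoef a b c f) z)%C.
Proof.
intros Hc Hz; unfold hohlov; rewrite CPSeries_step; [|apply subexp_unshift|exact Hz].
- unfold hadamard at 1; simpl PS_incr_1.
  change (0 * Acoef f 0%nat + z * CPSeries (hcoef a b c f) z
    = z * CPSeries (hcoef a b c f) z)%C.
  ring.
- exact (subexp_hcoef a b c f Hc).
Qed.

Lemma CPSeries_INR (u : nat -> C) (z : C) : subexp u -> Cmod z < 1 ->
  CPSeries (fun n => RtoC (INR n) * u n)%C z = (z * CPSeries (dcoef u) z)%C.
Proof.
intros Hu Hz.
rewrite CPSeries_step; [|apply subexp_mult; [apply subexp_INR|exact Hu]|exact Hz].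
unfold dcoef; simpl INR at 1; ring.
Qed.

(** For a > 0 this says (a+1)_n / (a)_n = 1 + n / a; as the factor n acts on power series as z d/dz,
    raising [a] by 1 adds z P' / a to [P]. *)
Lemma poch_succ_l (a : R) (n : nat) : a * poch (a + 1) n = poch a n * (a + INR n).
Proof.
induction n as [|n IH]; [simpl; ring|].
change (a * (poch (a + 1) n * (a + 1 + INR n)) = poch a n * (a + INR n) * (a + INR (S n))).
rewrite S_INR, <- Rmult_assoc, IH; ring.
Qed.

Lemma hohlov_succ (a b c : R) (f : classA) (z : C) : 0 < a -> 0 < c -> Cmod z < 1 ->
  hohlov (a + 1) b c f z = (z * (CPSeries (hcoef a b c f) z +
    RtoC (/ a) * (z * CPSeries (dcoef (hcoef a b c f)) z)))%C.
Proof.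
intros Ha Hc Hz; rewrite hohlov_eq by assumption; f_equal.
assert (Hu := subexp_hcoef a b c f Hc).
assert (Hnu : subexp (fun n => RtoC (INR n) * hcoef a b c f n)%C)
  by (apply subexp_mult; [apply subexp_INR|exact Hu]).
rewrite <- CPSeries_INR, <- CPSeries_scal by assumption.
rewrite <- CPSeries_plus; [|exact Hu| |exact Hz].
- apply CPSeries_ext; intros n; unfold hcoef.
  replace (hyp2F1_coef (a + 1) b c n)
    with (hyp2F1_coef a b c n * (1 + RtoC (/ a) * RtoC (INR n)))%C; [ring|].
  unfold hyp2F1_coef; rewrite <- !RtoC_mult, <- RtoC_plus, <- RtoC_mult; f_equal.
  replace (poch (a + 1) n) with (poch a n * (a + INR n) / a)
    by (rewrite <- poch_succ_l; field; lra).
  pose proof (poch_pos c n Hc).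
  field; repeat split; first [apply INR_fact_neq_0|lra].
- apply subexp_mult; [|exact Hnu].
  intros q Hq; exists (Cmod (RtoC (/ a))); intros n.
  generalize (Cmod_ge_0 (RtoC (/ a))) (pow_R1_Rle q n); nra.
Qed.

Lemma quotient1_hohlov_id (a b c : R) (f : classA) (z : C) : 0 < c -> Cmod z < 1 ->
  quotient1 (hohlov a b c f) (fun z => z) z = CPSeries (hcoef a b c f) z.
Proof.
intros Hc Hz; unfold quotient1; destruct (Ceq_dec z 0) as [->|Hnz].
- rewrite CPSeries_0, hcoef_0; [reflexivity|now apply subexp_hcoef].
- rewrite hohlov_eq by assumption; field; exact Hnz.
Qed.

Lemma quotient1_hohlov_succ (a b c : R) (f : classA) (z : C) :
  0 < a -> 0 < c -> Cmod z < 1 -> CPSeries (hcoef a b c f) z <> 0%C ->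
  quotient1 (hohlov (a + 1) b c f) (hohlov a b c f) z =
  (1 + RtoC (/ a) * (z * CPSeries (dcoef (hcoef a b c f)) z / CPSeries (hcoef a b c f) z))%C.
Proof.
intros Ha Hc Hz HP; unfold quotient1; destruct (Ceq_dec z 0) as [->|Hnz].
- field; exact HP.
- rewrite hohlov_succ, hohlov_eq by assumption; field; now split.
Qed.

Lemma Re_one_plus_scal (k : R) (z : C) : Re (1 + RtoC k * z)%C = 1 + k * Re z.
Proof. destruct z; simpl; ring. Qed.

(** This strip suffices for the subordination: there the exponential will be 1 + omega with |omega|
    < 1, a point of the right half-plane. *)
Lemma Clog_Cexp (w : C) : - (PI / 2) < Im w < PI / 2 -> Clog (Cexp w) = w.
Proof.
intros Hw; unfold Clog; rewrite Cmod_Cexp, ln_exp.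
apply injective_projections; [reflexivity|]; simpl.
assert (He := exp_pos (Re w)); pose proof PI_RGT_0.
unfold Carg; rewrite Cmod_Cexp.
replace (Re (Cexp w) / exp (Re w)) with (cos (Im w)) by (simpl; unfold Re; field; unfold Re in He; lra).
change (Im (Cexp w)) with (exp (Re w) * sin (Im w)).
change (snd w) with (Im w).
destruct (Rle_lt_dec 0 (Im w)) as [Hi|Hi].
- assert (0 <= sin (Im w)) by (apply sin_ge_0; lra).
  destruct (Rle_dec 0 (exp (Re w) * sin (Im w))) as [_|Hn]; [|exfalso; apply Hn; nra].
  apply acos_cos; lra.
- assert (sin (Im w) < 0) by (apply sin_lt_0_var; lra).
  destruct (Rle_dec 0 (exp (Re w) * sin (Im w))) as [Hn|_]; [exfalso; nra|].
  rewrite <- cos_neg, acos_cos; lra.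
Qed.

(** Selects the branch: a positive cosine fixes an angle only up to multiples of 2 PI, but an angle
    that starts at 0 and varies continuously cannot pass PI / 2, where the cosine vanishes. *)
Lemma below_half_PI (f : R -> R) : (forall t, 0 <= t <= 1 -> continuity_pt f t) ->
  f 0 = 0 -> (forall t, 0 <= t <= 1 -> 0 < cos (f t)) -> f 1 < PI / 2.
Proof.
intros Hf H0 Hc; apply Rnot_le_lt; intros Hge; pose proof PI_RGT_0.
destruct (Rle_lt_or_eq_dec _ _ Hge) as [Hgt|Heq].
- destruct (Ranalysis5.IVT_interv (fun t => f t - PI / 2) 0 1) as [t [Ht E]].
  + intros t Ht; apply continuity_pt_minus; [apply Hf, Ht|].
    apply continuity_pt_const; now intros x y.
  + lra.
  + rewrite H0; lra.
  + lra.
  + specialize (Hc t Ht); replace (f t) with (PI / 2) in Hc by lra.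
    rewrite cos_PI2 in Hc; lra.
- specialize (Hc 1 ltac:(lra)); rewrite <- Heq, cos_PI2 in Hc; lra.
Qed.

Lemma hohlov_subordinate (a b c gamma : R) (f : classA) :
  0 < a -> 0 < c -> 0 < gamma ->
  (forall z : C, in_disk z ->
     Re (quotient1 (hohlov (a + 1) b c f) (hohlov a b c f) z) < 1 + 1 / (2 * a * gamma)) ->
  subordinate (quotient1 (hohlov a b c f) (fun z => z))
    (fun z => Cpower (1 + z)%C (RtoC (1 / gamma))).
Proof.
intros Ha Hc Hg Hre; set (u := hcoef a b c f).
assert (Hu : subexp u) by (now apply subexp_hcoef).
assert (Hlog : forall z, Cmod z < 1 -> CPSeries u z <> 0%C ->
  Re (z * CPSeries (dcoef u) z / CPSeries u z)%C < / (2 * gamma)).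
{ intros z Hz Hnz; specialize (Hre z Hz).
  rewrite quotient1_hohlov_succ, Re_one_plus_scal in Hre by assumption; fold u in Hre.
  apply (Rmult_lt_reg_l (/ a)); [now apply Rinv_0_lt_compat|].
  replace (/ a * / (2 * gamma)) with (1 / (2 * a * gamma)) by (field; lra); lra. }
assert (Hnz := series_zero_free u gamma Hg Hu (hcoef_0 a b c f) Hlog).
assert (HP0 : CPSeries u 0 = 1%C) by (rewrite CPSeries_0; [apply hcoef_0|exact Hu]).
assert (Hd : forall z, Cmod z < 1 -> cder (CPSeries u) z (CPSeries (dcoef u) z))
  by (intros z Hz; now apply CPSeries_cder).
assert (Hdd : forall z, Cmod z < 1 -> exists l, cder (CPSeries (dcoef u)) z l).
{ intros z Hz; eexists; apply CPSeries_cder; [now apply subexp_dcoef|exact Hz]. }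
destruct (log_exists _ _ 1 Rlt_0_1 Hd Hdd Hnz HP0) as [L HL].
assert (HS := log_schwarz _ _ L 1 gamma Hg Rlt_0_1 HL Hd Hdd Hnz
  (fun z Hz => Hlog z Hz (Hnz z Hz))).
destruct HL as [L0 HL].
assert (Hlt : forall z, Cmod z < 1 -> Cmod (Cexp (gamma * L z) - 1)%C < 1).
{ intros z Hz; specialize (HS z Hz); lra. }
exists (fun z => Cexp (gamma * L z) - 1)%C; split; [|split; [|split]].
- intros z Hz; eapply cder_ex_derive, cder_minus; [|apply cder_const].
  apply (cder_Cexp (fun z => gamma * L z)%C), cder_scal, HL, Hz.
- rewrite L0, Cmult_0_r, Cexp_0; ring.
- exact Hlt.
- intros z Hz; rewrite quotient1_hohlov_id by assumption; fold u.
  replace (1 + (Cexp (gamma * L z) - 1))%C with (Cexp (gamma * L z)) by ring.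
  (* Once [gamma * L z] is known to be the principal logarithm of 1 + omega(z), the principal power
     is exp(L z), which is P(z). *)
  unfold Cpower; rewrite Clog_Cexp.
  + destruct (HL z Hz) as [_ <-]; f_equal.
    rewrite Cmult_assoc, <- RtoC_mult.
    replace (1 / gamma * gamma) with 1 by (field; lra); ring.
  + assert (Hin : forall t, 0 <= t <= 1 -> Cmod (0 + t * z)%C < 1).
    { intros t Ht; unfold in_disk in Hz; rewrite Cplus_0_l, Cmod_mult, Cmod_R, Rabs_pos_eq by lra.
      generalize (Cmod_ge_0 z); nra. }
    (* The angle is followed along the segment from 0 to [z], and [below_half_PI] is applied to it
       and to its negative. *)
    set (th := fun t : R => Im (gamma * L (0 + t * z))%C).
    assert (Hcont : forall t, 0 <= t <= 1 -> continuity_pt th t).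
    { intros t Ht; apply derivable_continuous_pt; eexists; apply is_derive_Reals.
      apply (cder_line_im (fun y => gamma * L y)%C).
      apply cder_scal, HL, Hin, Ht. }
    assert (Hth0 : th 0 = 0).
    { unfold th; replace (0 + 0 * z)%C with (RtoC 0) by ring.
      rewrite L0; simpl; ring. }
    assert (Hth1 : Im (gamma * L z)%C = th 1).
    { unfold th; now rewrite Cplus_0_l, Cmult_1_l. }
    assert (Hcos : forall t, 0 <= t <= 1 -> 0 < cos (th t)).
    { intros t Ht; specialize (Hlt _ (Hin t Ht)); unfold th.
      set (l := (gamma * L (0 + t * z))%C) in *.
      pose proof (re_le_Cmod (Cexp l - 1)%C) as H1.
      pose proof (Rle_lt_trans _ _ _ H1 Hlt) as H2; apply Rabs_def2 in H2.
      replace (Re (Cexp l - 1)%C) with (exp (Re l) * cos (Im l) - 1) in H2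
        by (unfold Cexp; simpl; ring).
      pose proof (exp_pos (Re l)); nra. }
    rewrite Hth1; split; [|now apply below_half_PI].
    assert (- th 1 < PI / 2); [|lra].
    apply (below_half_PI (fun t => - th t)).
    * intros t Ht; apply (continuity_pt_opp th), Hcont, Ht.
    * rewrite Hth0; ring.
    * intros t Ht; rewrite cos_neg; apply Hcos, Ht.
Qed.

(** The coefficients of (1 + z)^s, with n! written as [poch 1 n] so that [subexp_poch] applies. *)
Definition binom_coef (s : R) (n : nat) : C :=
  (RtoC (poch (- s) n / poch 1 n) * RtoC ((-1) ^ n))%C.

Lemma subexp_binom_coef (s : R) : subexp (binom_coef s).
Proof.
apply subexp_mult; [apply subexp_poch; lra|].
intros q Hq; exists 1; intros n; rewrite Cmod_R, <- RPow_abs.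
replace (Rabs (-1)) with 1 by (rewrite Rabs_left; lra).
rewrite pow1; generalize (pow_R1_Rle q n); lra.
Qed.

(** The recurrence (n + 1) c_(n+1) + n c_n = s c_n, summed. It identifies the series with exp(s
    Log1p) and also gives z P' / P = s z / (1 + z). *)
Lemma binom_ode (s : R) (z : C) : Cmod z < 1 ->
  ((1 + z) * CPSeries (dcoef (binom_coef s)) z = s * CPSeries (binom_coef s) z)%C.
Proof.
intros Hz; assert (Hu := subexp_binom_coef s).
assert (Hnu : subexp (fun n => RtoC (INR n) * binom_coef s n)%C)
  by (apply subexp_mult; [apply subexp_INR|exact Hu]).
rewrite <- (CPSeries_scal s) by assumption.
rewrite Cmult_plus_distr_r, Cmult_1_l, <- CPSeries_INR by assumption.
rewrite <- CPSeries_plus; [|now apply subexp_dcoef|exact Hnu|exact Hz].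
apply CPSeries_ext; intros n; unfold dcoef, binom_coef.
rewrite <- !RtoC_mult, <- RtoC_plus; f_equal.
cbn [poch pow]; rewrite S_INR; pose proof (poch_pos 1 n Rlt_0_1); pose proof (pos_INR n).
field; lra.
Qed.

Lemma binom_eq (s : R) (z : C) : Cmod z < 1 ->
  CPSeries (binom_coef s) z = Cexp (s * Log1p z).
Proof.
intros Hz; assert (Hu := subexp_binom_coef s).
assert (E : (CPSeries (binom_coef s) z * Cexp (RtoC (- s) * Log1p z) =
  CPSeries (binom_coef s) 0 * Cexp (RtoC (- s) * Log1p 0))%C).
{ apply (cder_zero_const
    (fun z => CPSeries (binom_coef s) z * Cexp (RtoC (- s) * Log1p z))%C 1); [|exact Hz].
  intros y Hy; pose proof (one_plus_neq_0 y Hy) as Hy0; eapply cder_eq.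
  - apply cder_mult; [apply CPSeries_cder; assumption|].
    apply (cder_Cexp (fun z => RtoC (- s) * Log1p z)%C), cder_scal, Log1p_cder, Hy.
  - cbv beta; pose proof (binom_ode s y Hy) as HO.
    replace (CPSeries (dcoef (binom_coef s)) y)
      with ((1 + y) * CPSeries (dcoef (binom_coef s)) y * / (1 + y))%C by (field; exact Hy0).
    rewrite HO, RtoC_opp; field; exact Hy0. }
rewrite Log1p_0, Cmult_0_r, Cexp_0, CPSeries_0 in E by exact Hu.
replace (binom_coef s 0%nat) with (RtoC 1) in E.
2:{ unfold binom_coef; simpl; rewrite <- RtoC_mult; f_equal; field. }
replace (CPSeries (binom_coef s) z) with
  (CPSeries (binom_coef s) z * (Cexp (RtoC (- s) * Log1p z) * Cexp (s * Log1p z)))%C.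
- rewrite Cmult_assoc, E; ring.
- rewrite <- Cexp_plus, RtoC_opp.
  replace (- s * Log1p z + s * Log1p z)%C with (RtoC 0) by ring; rewrite Cexp_0; ring.
Qed.

(** Multiplied by |1 + z|^2, the claim becomes |z|^2 < 1. *)
Lemma Re_half_plane (z : C) : Cmod z < 1 -> Re (z / (1 + z))%C < / 2.
Proof.
intros Hz; pose proof (one_plus_neq_0 z Hz) as H0.
assert (HN : Cnorm2 z < 1) by (rewrite Cnorm2_Cmod; generalize (Cmod_ge_0 z); nra).
assert (HD : 0 < Cnorm2 (1 + z)%C).
{ rewrite Cnorm2_Cmod; apply Cmod_gt_0 in H0; nra. }
destruct z as [x y]; unfold Cnorm2 in *; simpl in *.
set (D := (1 + x) * (1 + x) + (0 + y) * (0 + y)) in *.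
replace (x * ((1 + x) / ((1 + x) * ((1 + x) * 1) + (0 + y) * ((0 + y) * 1))) -
  y * (- (0 + y) / ((1 + x) * ((1 + x) * 1) + (0 + y) * ((0 + y) * 1))))
  with ((x * (1 + x) + y * y) / D).
2:{ unfold D; field; unfold D in HD; lra. }
apply (Rmult_lt_reg_r D); [exact HD|].
unfold Rdiv; rewrite Rmult_assoc, Rinv_l, Rmult_1_r by lra.
unfold D; nra.
Qed.

(** With positive parameters the operator multiplies each coefficient by a nonzero number, so the
    wanted coefficients are divided by it; the reciprocal multipliers are subexponential as well. *)
Lemma exists_hcoef_binom (a b c s : R) : 0 < a -> 0 < b -> 0 < c ->
  exists f : classA, forall n, hcoef a b c f n = binom_coef s n.
Proof.
intros Ha Hb Hc.
set (A := fun n => match n with O => RtoC 0 | S k =>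
  (RtoC (poch c k / poch a k) * RtoC (poch 1 k / poch b k) * binom_coef s k)%C end).
assert (HA : subexp A).
{ apply subexp_unshift; simpl.
  apply subexp_mult; [apply subexp_mult; apply subexp_poch; lra|apply subexp_binom_coef]. }
assert (HA1 : A 1%nat = 1%C).
{ unfold A, binom_coef; simpl; rewrite <- !RtoC_mult; f_equal; field. }
exists (classA_of_coef A HA eq_refl HA1); intros n; unfold hcoef; simpl Acoef.
unfold A, hyp2F1_coef; rewrite <- poch_1_fact, Cmult_assoc, <- !RtoC_mult.
pose proof (poch_pos a n Ha); pose proof (poch_pos b n Hb); pose proof (poch_pos c n Hc).
pose proof (poch_pos 1 n Rlt_0_1).
match goal with |- (RtoC ?x * _)%C = _ => replace x with 1 by (field; lra) end; ring.
Qed.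

(** Growth near 1 decides: |(1 + omega)^p| never exceeds 2^p, while (1 + x)^s approaches the larger
    2^s as x tends to 1. *)
Lemma binom_not_subordinate (s p : R) (g : C -> C) : 0 < p < s ->
  (forall z, Cmod z < 1 -> g z = CPSeries (binom_coef s) z) ->
  ~ subordinate g (fun z => Cpower (1 + z)%C (RtoC p)).
Proof.
intros Hps Hg [w [_ [_ [Hw1 Hw]]]].
assert (Hln2 : 0 < ln 2) by (rewrite <- ln_1; apply ln_increasing; lra).
(* With 1 + x = 2^th and [th] midway between p / s and 1, (1 + x)^s = 2^((s + p) / 2), which is more
   than 2^p. *)
set (th := (1 + p / s) / 2).
assert (Hps1 : 0 < p / s < 1).
{ split; [apply Rdiv_lt_0_compat; lra|].
  apply (Rmult_lt_reg_r s); [lra|]; unfold Rdiv; rewrite Rmult_assoc, Rinv_l; lra. }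
set (x := exp (th * ln 2) - 1).
assert (Hx : 0 < x < 1).
{ unfold x; split.
  - assert (exp 0 < exp (th * ln 2)) by (apply exp_increasing; unfold th; nra).
    rewrite exp_0 in H; lra.
  - assert (exp (th * ln 2) < exp (ln 2)) by (apply exp_increasing; unfold th; nra).
    rewrite exp_ln in H; lra. }
assert (Hxd : Cmod x < 1) by (rewrite Cmod_R, Rabs_pos_eq; lra).
specialize (Hw x Hxd); specialize (Hw1 x Hxd).
rewrite Hg, binom_eq in Hw by exact Hxd.
apply (f_equal Cmod) in Hw; unfold Cpower in Hw; rewrite !Cmod_Cexp in Hw.
apply exp_inv in Hw.
assert (HL : Re (Log1p x) = th * ln 2).
{ apply exp_inv; rewrite <- Cmod_Cexp, Cexp_Log1p, <- RtoC_plus, Cmod_R by exact Hxd.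
  rewrite Rabs_pos_eq; unfold x in *; lra. }
replace (Re (s * Log1p x)%C) with (s * Re (Log1p x)) in Hw
  by (destruct (Log1p x); simpl; ring).
replace (Re (p * Clog (1 + w x))%C) with (p * ln (Cmod (1 + w x))) in Hw
  by (unfold Clog; simpl; ring).
rewrite HL in Hw.
assert (H2 : ln (Cmod (1 + w x)) <= ln 2).
{ apply ln_le.
  - apply Cmod_gt_0, one_plus_neq_0, Hw1.
  - eapply Rle_trans; [apply Cmod_triangle|]; rewrite Cmod_1; lra. }
apply (Rmult_le_compat_l p) in H2; [|lra].
replace (s * (th * ln 2)) with ((s + p) / 2 * ln 2) in Hw by (unfold th; field; lra).
nra.
Qed.

Theorem theorem2p20 (a b c gamma : R)
  (hc : 0 < c) (hac : a >= c) (hbc : b >= c) (hgamma : gamma > 0) :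
  (forall f : classA,
     (forall z : C, in_disk z ->
        Re (quotient1 (hohlov (a + 1) b c f) (hohlov a b c f) z)
          < 1 + 1 / (2 * a * gamma)) ->
     subordinate (quotient1 (hohlov a b c f) (fun z => z))
                 (fun z => Cpower (1 + z)%C (RtoC (1 / gamma))))
  /\
  (forall K : R, 1 + 1 / (2 * a * gamma) < K ->
     exists f : classA,
       (forall z : C, in_disk z -> z <> RtoC 0 -> hohlov a b c f z <> RtoC 0) /\
       (forall z : C, in_disk z ->
          Re (quotient1 (hohlov (a + 1) b c f) (hohlov a b c f) z) < K) /\
       ~ subordinate (quotient1 (hohlov a b c f) (fun z => z))
                     (fun z => Cpower (1 + z)%C (RtoC (1 / gamma)))).
Proof.
assert (Ha : 0 < a) by lra; assert (Hb : 0 < b) by lra; split.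
- intros f Hf; now apply hohlov_subordinate.
(* For P = (1 + z)^s the quotient is 1 + (s / a) z / (1 + z), with real part below 1 + s / (2 a) =
   K; and the assumption on [K] amounts to s > 1 / gamma. *)
- intros K HK; set (s := 2 * a * (K - 1)).
  assert (Hs : 0 < 1 / gamma < s).
  { split; [apply Rdiv_lt_0_compat; lra|]; unfold s.
    replace (1 / gamma) with (2 * a * (1 / (2 * a * gamma))) by (field; lra).
    apply Rmult_lt_compat_l; lra. }
  destruct (exists_hcoef_binom a b c s Ha Hb hc) as [f Hf]; exists f.
  assert (HP : forall z, CPSeries (hcoef a b c f) z = CPSeries (binom_coef s) z)
    by (intros z; now apply CPSeries_ext).
  assert (HP1 : forall z, CPSeries (dcoef (hcoef a b c f)) z
     = CPSeries (dcoef (binom_coef s)) z)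
    by (intros z; apply CPSeries_ext; intros n; unfold dcoef; now rewrite Hf).
  assert (Hnz : forall z, Cmod z < 1 -> CPSeries (hcoef a b c f) z <> 0%C)
    by (intros z Hz; rewrite HP, binom_eq by exact Hz; apply Cexp_neq_0).
  split; [|split].
  (* Nonvanishing ensures that the bound on the quotient never comes from the default value of a
     division by 0. *)
  + intros z Hz Hz0; rewrite hohlov_eq by assumption.
    apply Cmult_neq_0; [exact Hz0|now apply Hnz].
  + intros z Hz; rewrite quotient1_hohlov_succ by auto.
    pose proof (one_plus_neq_0 z Hz) as H1.
    replace (z * CPSeries (dcoef (hcoef a b c f)) z / CPSeries (hcoef a b c f) z)%C
      with (RtoC s * (z / (1 + z)))%C.
    2:{ pose proof (Hnz z Hz) as Hn; pose proof (binom_ode s z Hz) as HO.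
        rewrite HP in Hn |- *; rewrite HP1.
        replace (CPSeries (dcoef (binom_coef s)) z)
          with ((1 + z) * CPSeries (dcoef (binom_coef s)) z * / (1 + z))%C
          by (field; exact H1).
        rewrite HO; field; now split. }
    rewrite Cmult_assoc, <- RtoC_mult, Re_one_plus_scal.
    replace (/ a * s) with (2 * (K - 1)) by (unfold s; field; lra).
    assert (0 < K - 1).
    { assert (0 < 1 / (2 * a * gamma)) by (apply Rdiv_lt_0_compat; [lra|];
        repeat apply Rmult_lt_0_compat; lra); lra. }
    pose proof (Re_half_plane z Hz); nra.
  + apply (binom_not_subordinate s); [exact Hs|].
    intros z Hz; rewrite quotient1_hohlov_id by assumption; apply HP.
Qed.
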